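(* Let $X\subset \mathbb{P}^N$ be a smooth irreducible non-degenerate complex projective variety of dimension $n\geq 1$ and codimension $c=N-n$, covered by the lines of an irreducible family of lines $\mathcal{L}$. Let $a=\dim(\mathcal{L}_x)$ for $x\in X$ a general point. If $a\geq n-c$, then $a\leq \frac{n+c-3}{2}$.
   Context: We work over $\mathbb{C}$. Non-degenerate means not contained in a hyperplane. $\mathcal{L}$ denotes an irreducible component of the Hilbert scheme of lines contained in $X$; for $x\in X$, $\mathcal{L}_{x}$ is the variety of lines from $\mathcal{L}$ passing through $x$. $X$ is covered by the lines in $\mathcal{L}$ if $\mathcal{L}_{x}\neq\emptyset$ for $x\in X$ general. The integer $a$ is $\dim(\mathcal{L}_{x})$ for general $x\in X$. *)

(* Defs.v *)
From HB Require Import structures.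
From mathcomp Require Import all_boot all_order all_algebra.
From mathcomp Require Import boolp classical_sets topology.
From mathcomp Require Import mpoly.

Set Implicit Arguments.
Unset Strict Implicit.
Unset Printing Implicit Defensive.

Import GRing.Theory.
Local Open Scope classical_set_scope.
Local Open Scope ring_scope.

Definition homogeneous (F : closedFieldType) m (f : {mpoly F[m]}) : Prop :=
  exists d : nat, f \is d.-homog.

(* [coord t] is a vector of homogeneous coordinates of the point [t]. [S] is
   meant to consist of homogeneous polynomials, so that vanishing does not
   depend on the chosen representative. *)
Definition zero_locus (F : closedFieldType) m T (coord : T -> 'rV[F]_m)
    (S : set {mpoly F[m]}) : set T :=
  [set t | forall f, S f -> f.@[coord t 0] = 0].

Definition zariski_open (F : closedFieldType) m T (coord : T -> 'rV[F]_m)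
    (U : set T) : Prop :=
  exists2 S : set {mpoly F[m]}, S `<=` @homogeneous F m
    & ~` U = zero_locus coord S.

Section ZariskiOpen.
Variables (F : closedFieldType) (m : nat) (T : Type) (coord : T -> 'rV[F]_m).

Lemma zariski_openT : zariski_open coord setT.
Proof.
exists [set 1]; first by move=> _ ->; exists 0%N; exact: dhomog1.
rewrite setCT; apply/seteqP; split=> // t /(_ _ erefl).
by rewrite meval1 => /eqP; rewrite oner_eq0.
Qed.

Lemma zariski_openI : setI_closed (zariski_open coord).
Proof.
move=> U V [S hS eU] [S' hS' eV].
exists [set h | exists f g, [/\ S f, S' g & h = f * g]].
  move=> _ [f [g [/hS [d hf] /hS' [e hg] ->]]].
  by exists (d + e)%N; exact: dhomogM.
rewrite setCI eU eV; apply/seteqP; split=> t.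
  case=> ht _ [f [g [Sf Sg ->]]]; rewrite mevalM.
    by rewrite ht // mul0r.
  by rewrite [X in _ * X]ht // mulr0.
move=> ht; have [?|/existsNP[f /not_implyP[Sf /eqP nf]]] :=
  pselect (zero_locus coord S t); first by left.
right=> g Sg; have /eqP : (f * g).@[coord t 0] = 0 by apply: ht; exists f, g.
by rewrite mevalM mulf_eq0 (negbTE nf) => /eqP.
Qed.

Lemma zariski_open_bigU (I : Type) (U : I -> set T) :
  (forall i, zariski_open coord (U i)) -> zariski_open coord (\bigcup_i U i).
Proof.
move=> oU; exists [set f | exists i (S : set {mpoly F[m]}),
  [/\ S `<=` @homogeneous F m, ~` U i = zero_locus coord S & S f]].
  by move=> f [i [S [hS _ /hS]]].
rewrite setC_bigcup; apply/seteqP; split=> t.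
  move=> ht f [i [S [_ eU Sf]]].
  have : zero_locus coord S t by rewrite -eU; exact: ht.
  exact.
move=> ht i _; have [S hS eU] := oU i.
by rewrite eU => f Sf; apply: ht; exists i, S.
Qed.

End ZariskiOpen.

(* The projective space P^N and the Grassmannian of lines in P^N: linear
   subspaces of F^(N+1) of dimension 1 and 2 respectively. *)
Definition proj (F : closedFieldType) (N : nat) : Type :=
  {p : {vspace 'rV[F]_N.+1} | \dim p == 1%N}.
Definition line (F : closedFieldType) (N : nat) : Type :=
  {l : {vspace 'rV[F]_N.+1} | \dim l == 2%N}.

HB.instance Definition _ (F : closedFieldType) N :=
  Choice.copy (proj F N) {p : {vspace 'rV[F]_N.+1} | \dim p == 1%N}.
HB.instance Definition _ (F : closedFieldType) N :=
  Choice.copy (line F N) {l : {vspace 'rV[F]_N.+1} | \dim l == 2%N}.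

Definition homcoord (F : closedFieldType) N (p : proj F N) : 'rV[F]_N.+1 :=
  vpick (val p).

(* The entries are the Plucker coordinates u_i v_j - u_j v_i, for (u, v) a
   basis of the plane corresponding to the line. *)
Definition plucker (F : closedFieldType) N (l : line F N) :
    'rV[F]_(N.+1 * N.+1) :=
  let u := (vbasis (val l))`_0 in let v := (vbasis (val l))`_1 in
  mxvec (u^T *m v - v^T *m u).

HB.instance Definition _ (F : closedFieldType) N :=
  isOpenTopological.Build (proj F N) (zariski_openT (@homcoord F N))
    (zariski_openI (coord := @homcoord F N))
    (@zariski_open_bigU F _ _ (@homcoord F N)).
HB.instance Definition _ (F : closedFieldType) N :=
  isOpenTopological.Build (line F N) (zariski_openT (@plucker F N))
    (zariski_openI (coord := @plucker F N))
    (@zariski_open_bigU F _ _ (@plucker F N)).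

Lemma openE_proj (F : closedFieldType) N (U : set (proj F N)) :
  open U = zariski_open (@homcoord F N) U.
Proof. by []. Qed.

Lemma openE_line (F : closedFieldType) N (U : set (line F N)) :
  open U = zariski_open (@plucker F N) U.
Proof. by []. Qed.

Lemma proj_closedE (F : closedFieldType) N (Z : set (proj F N)) :
  closed Z <-> exists2 S : set {mpoly F[N.+1]}, S `<=` @homogeneous F N.+1
    & Z = zero_locus (@homcoord F N) S.
Proof.
by rewrite -openC openE_proj; split=> -[S hS eZ]; exists S => //; move: eZ;
  rewrite setCK.
Qed.

Lemma line_closedE (F : closedFieldType) N (Z : set (line F N)) :
  closed Z <-> exists2 S : set {mpoly F[N.+1 * N.+1]},
    S `<=` @homogeneous F (N.+1 * N.+1) & Z = zero_locus (@plucker F N) S.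
Proof.
by rewrite -openC openE_line; split=> -[S hS eZ]; exists S => //; move: eZ;
  rewrite setCK.
Qed.

Definition irreducible (T : topologicalType) (S : set T) : Prop :=
  S !=set0 /\ forall A B : set T, closed A -> closed B ->
    S `<=` A `|` B -> S `<=` A \/ S `<=` B.

Definition irreducible_component (T : topologicalType) (S L : set T) : Prop :=
  [/\ L `<=` S, irreducible L &
      forall L' : set T, L' `<=` S -> irreducible L' -> L `<=` L' -> L' = L].

(* A chain Z 0 < ... < Z k of irreducible subsets of S, closed in S for the
   induced topology. *)
Definition irreducible_chain (T : topologicalType) (S : set T) (k : nat)
    (Z : nat -> set T) : Prop :=
  (forall i, (i <= k)%N -> irreducible (Z i) /\ Z i = S `&` closure (Z i)) /\
  (forall i, (i < k)%N -> Z i `<` Z i.+1).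

(* Krull dimension; the empty set has none. *)
Definition has_dim (T : topologicalType) (S : set T) (k : nat) : Prop :=
  (exists Z, irreducible_chain S k Z) /\
  (forall j Z, irreducible_chain S j Z -> (j <= k)%N).

(* [P] holds at a general point of the irreducible set [X]. *)
Definition general_point (T : topologicalType) (X : set T) (P : T -> Prop) :
    Prop :=
  exists U : set T, [/\ open U, X `&` U !=set0 & forall x, X x -> U x -> P x].

Definition projective_variety (F : closedFieldType) N (X : set (proj F N)) :
    Prop :=
  closed X /\ irreducible X.

Definition non_degenerate (F : closedFieldType) N (X : set (proj F N)) : Prop :=
  forall H : {vspace 'rV[F]_N.+1}, \dim H = N ->
    exists2 p, X p & ~~ (val p <= H)%VS.

Definition homogeneous_ideal (F : closedFieldType) N (X : set (proj F N)) :
    set {mpoly F[N.+1]} :=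
  [set f | homogeneous f /\ forall p, X p -> f.@[homcoord p 0] = 0].

(* The affine cone over the embedded tangent space of X at p. *)
Definition tangent_cone (F : closedFieldType) N (X : set (proj F N))
    (p : proj F N) : set 'rV[F]_N.+1 :=
  [set v | forall f, homogeneous_ideal X f ->
    \sum_(i < N.+1) f^`M(i).@[homcoord p 0] * v 0 i = 0].

(* X, irreducible of dimension n, is smooth: its embedded tangent spaces all
   have projective dimension n. *)
Definition smooth (F : closedFieldType) N (X : set (proj F N)) (n : nat) :
    Prop :=
  forall p, X p -> exists2 T : {vspace 'rV[F]_N.+1},
    \dim T = n.+1 & forall v, v \in T <-> tangent_cone X p v.

Definition on_line (F : closedFieldType) N (p : proj F N) (l : line F N) :
    Prop :=
  (val p <= val l)%VS.

Definition lines_in (F : closedFieldType) N (X : set (proj F N)) :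
    set (line F N) :=
  [set l | forall p, on_line p l -> X p].

Definition lines_through (F : closedFieldType) N (L : set (line F N))
    (x : proj F N) : set (line F N) :=
  [set l | L l /\ on_line x l].

Definition covered_by (F : closedFieldType) N (X : set (proj F N))
    (L : set (line F N)) : Prop :=
  general_point X (fun x => lines_through L x !=set0).

(* Main.v *)
(* Fix a point x of X with dim L_x = a. Let V be the ambient vector space and
   write dimensions of affine cones: X^ has dimension n + 1 and the cone C swept
   out by the lines of L through x contains a chain of irreducible cones
   0 < Kx < C_0 < ... < C_a, so it has dimension at least a + 2. All of C lies in
   the tangent space T_x, so at a general y in C the tangent spaces T_x and T_y
   share a space of dimension a + 2 (the tangent space of C at y), and the linear
   forms h vanishing on T_x + T_y form a space of dimension at least
   e = a + c + 1 - n, which is positive by hypothesis. Consider the map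
     (y, h, x') |-> (h, y - x'),   y in C, h in (T_x + T_y)^perp, x' in X^,
   from a variety of dimension at least (a + 2) + e + (n + 1) to
   T_x^perp x V, of dimension c + (n + c + 1). As in Zak's theorem on tangencies,
   it is finite over the open set h(y - x') <> 0, which it meets because X is
   nondegenerate: if y went to infinity with p = y - x' bounded, its limit
   direction u would be a point of X such that p lies in T_u and h vanishes on
   T_u, whence h(p) = 0. Comparing dimensions gives 2a + 3 <= n + c.

   Dimension is handled through derivations of function fields: a chain of s
   irreducible sets provides s independent derivations, and a derivation that
   kills the coordinates of h and p kills y, which is integral over them, hence
   everything. *)
Require Import Defs.
From HB Require Import structures.
From mathcomp Require Import all_boot all_order all_algebra.
From mathcomp Require Import complex.
From mathcomp Require Import ring_quotient ring zify.
From mathcomp Require Import boolp classical_sets reals topology.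
From mathcomp Require Import mpoly.

Set Implicit Arguments.
Unset Strict Implicit.
Unset Printing Implicit Defensive.

Import GRing.Theory.
Local Open Scope classical_set_scope.
Local Open Scope ring_scope.

(** * The field of a prime ideal *)

(** The comparison of dimensions becomes linear algebra: if the source carried more independent
    derivations than the target has coordinates, some nonzero combination [tau] of them would kill
    all those coordinates. The source contributes (a + 2) + (n + 1) + (a + c + 1 - n) derivations.
    The form h is measured by its [c] coordinates on a basis of the conormal space at x rather than
    by its n + c + 1 entries, which is what makes the count sharp enough.

    Limits at infinity become congruences. With t = 1 / y_i and u = t y, both u and u - t p = t x'
    satisfy the equations of X, so the differential at u of each equation takes at p a value
    divisible by t. Cramer's rule on Jacobian minors writes h as a combination of such differentials
    without introducing denominators other than the minor. Smoothness removes the minor through the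
    Nullstellensatz: the equations and the minors generate a power of the i-th variable, and this
    variable equals 1 at u. Hence t divides the nonzero constant h(p), so y_i is a fraction without
    excess degree, that is, integral. *)

Definition prime_ideal (A : comNzRingType) (Q : set A) : Prop :=
  [/\ Q 0, ~ Q 1, forall a x y, Q x -> Q y -> Q (a * x + y) &
      forall x y, Q (x * y) -> Q x \/ Q y].

Lemma fraction_quotient (R : idomainType) (z : {fraction R}) :
  exists n d : R, d != 0 /\ z = tofrac n / tofrac d.
Proof.
rewrite -[z]reprK; set r := repr z; have d0 := denom_ratioP r.
exists \n_r, \d_r; split=> //; apply: (mulIf (x := tofrac \d_r)).
  by rewrite tofrac_eq0.
rewrite divfK ?tofrac_eq0 //.
unlock FracField.tofrac; rewrite !piE; apply/eqP.
rewrite piE /FracField.equivf /FracField.mulf.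
by rewrite !numden_Ratio ?oner_neq0 ?mulr1 ?mul1r // mulrC.
Qed.

Section ResidueField.
Variables (A : comNzRingType) (Q : set A) (Q_prime : prime_ideal Q).

Definition ideal_mem (_ : prime_ideal Q) : {pred A} := fun a => `[< Q a >].
Local Notation I := (ideal_mem Q_prime).

Lemma ideal_mem_closed : idealr_closed I.
Proof.
have [Q0 Q1 QD _] := Q_prime; split; first exact/asboolP.
  by apply/negP => /asboolP.
by move=> a x y /asboolP Qx /asboolP Qy; apply/asboolP/QD.
Qed.

Lemma ideal_mem_prime : prime_idealr_closed I.
Proof.
have [_ _ _ QM] := Q_prime.
by move=> x y /asboolP/QM[] h; apply/orP; [left|right]; apply/asboolP.
Qed.

HB.instance Definition _ := isIdealr.Build A (ideal_mem Q_prime) ideal_mem_closed.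
HB.instance Definition _ :=
  isPrimeIdealrClosed.Build A (ideal_mem Q_prime) ideal_mem_prime.

Definition residue_ring : Type := {ideal_quot I}.
HB.instance Definition _ := GRing.ComNzRing.on residue_ring.

(** [{fraction _}] takes an integral domain equipped with an inverse operation, so units and
    inverses are picked classically. *)
Definition residue_unit : {pred residue_ring} :=
  fun x => `[< exists y, y * x = 1 >].
Definition residue_inv (x : residue_ring) : residue_ring :=
  xget x [set y | y * x = 1].

Lemma residue_mulVx : {in residue_unit, left_inverse 1 residue_inv *%R}.
Proof. by move=> x /asboolP[y yx]; rewrite /residue_inv; case: xgetP => // /(_ y). Qed.

Lemma residue_unitP (x y : residue_ring) : y * x = 1 -> x \in residue_unit.
Proof. by move=> yx; apply/asboolP; exists y. Qed.

Lemma residue_inv_out : {in [predC residue_unit], residue_inv =1 id}.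
Proof.
move=> x xU; rewrite /residue_inv; case: xgetP => // y _ yx.
by case/negP: xU; apply/asboolP; exists y.
Qed.

HB.instance Definition _ := GRing.ComNzRing_hasMulInverse.Build residue_ring
  residue_mulVx residue_unitP residue_inv_out.

Lemma residue_idomain : GRing.integral_domain_axiom residue_ring.
Proof. exact: Quotient.rquot_IdomainAxiom. Qed.

HB.instance Definition _ :=
  GRing.ComUnitRing_isIntegral.Build residue_ring residue_idomain.

(** Used twice: for the vanishing ideal of an irreducible set, where [L] is its function field, and
    for an abstract prime ideal in the Nullstellensatz. *)
Lemma residue_fieldP : exists (L : fieldType) (ev : {rmorphism A -> L}),
  (forall a, ev a = 0 <-> Q a) /\
  (forall z, exists a b, ev b != 0 /\ z = ev a / ev b).
Proof.
pose pi : {rmorphism A -> residue_ring} := \pi_({ideal_quot I})%qT.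
pose ev : {rmorphism A -> {fraction residue_ring}} :=
  (@tofrac residue_ring) \o pi.
exists {fraction residue_ring}, ev.
have evE a : ev a = 0 <-> Q a.
  split=> [/eqP|Qa].
    rewrite /ev /= tofrac_eq0 => /eqP e; apply/asboolP.
    rewrite -[a]subr0 -[`[< _ >]]/(_ \in I) Quotient.idealrBE; apply/eqP.
    by rewrite [LHS]e; exact/esym/(rmorph0 pi).
  apply/eqP; rewrite /ev /= tofrac_eq0; apply/eqP; rewrite -(rmorph0 pi).
  by apply/eqP; rewrite -Quotient.idealrBE subr0; apply/asboolP.
split=> // z.
have rE (r : residue_ring) : ev (repr r) = tofrac r.
  by rewrite /ev /= /pi /= reprK.
have [n [d [d0 ->]]] := fraction_quotient z.
by exists (repr n), (repr d); rewrite !rE tofrac_eq0 d0.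
Qed.

End ResidueField.

(** * Derivations *)

Section Derivations.
Variable L : fieldType.
Hypothesis char0 : forall n, n.+1%:R != 0 :> L.

Definition derivation (D : L -> L) : Prop :=
  (forall u v, D (u + v) = D u + D v) /\
  (forall u v, D (u * v) = u * D v + D u * v).

(* The graph of a derivation from a subring of L to L. *)
Definition partial_derivation (G : set (L * L)) : Prop :=
  [/\ G (1, 0),
      forall u v u' v', G (u, v) -> G (u', v') -> G (u - u', v - v'),
      forall u v u' v', G (u, v) -> G (u', v') -> G (u * u', u * v' + v * u') &
      forall v, G (0, v) -> v = 0].

Section Adjoin.
Variables (G : set (L * L)) (G_der : partial_derivation G) (theta : L).

Let G00 : G (0, 0).
Proof.
have [G1 GB _ _] := G_der.
by have := GB _ _ _ _ G1 G1; rewrite !subrr.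
Qed.

Let GD u v u' v' : G (u, v) -> G (u', v') -> G (u + u', v + v').
Proof.
have [_ GB _ _] := G_der => Guv Guv'.
by have := GB _ _ _ _ Guv (GB _ _ _ _ G00 Guv'); rewrite !sub0r !opprK.
Qed.

Let Gsum (I : Type) (r : seq I) (a b : I -> L) :
  (forall i, G (a i, b i)) -> G (\sum_(i <- r) a i, \sum_(i <- r) b i).
Proof.
move=> Gab; elim: r => [|i r IH]; first by rewrite !big_nil.
by rewrite !big_cons; apply: GD.
Qed.

(** Read [q] as the result of applying the derivation to the coefficients of [p]; the variable
    counts as a constant. *)
Let Gp (p q : {poly L}) := forall i, G (p`_i, q`_i).

Let GpB p q p' q' : Gp p q -> Gp p' q' -> Gp (p - p') (q - q').
Proof. by case: G_der => _ GB _ _ h h' i; rewrite !coefB; apply: GB. Qed.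

Let GpM p q p' q' : Gp p q -> Gp p' q' -> Gp (p * p') (p * q' + q * p').
Proof.
case: G_der => _ _ GM _ h h' i; rewrite coefD !coefM -big_split /=.
by apply: Gsum => j; apply: GM.
Qed.

Let GpC u v : G (u, v) -> Gp u%:P v%:P.
Proof. by move=> h i; rewrite !coefC; case: eqP. Qed.

Let GpX : Gp 'X 0.
Proof. by case: G_der => G1 _ _ _ i; rewrite coefX coef0; case: eqP. Qed.

Let GpXn k : Gp 'X^k 0.
Proof.
elim: k => [|k IH]; first by case: G_der => G1 _ _ _; apply: GpC.
by rewrite exprS; have := GpM GpX IH; rewrite mulr0 mul0r addr0.
Qed.

Let Gpderiv p q : Gp p q -> Gp p^`() q^`().
Proof.
have GMn u v n : G (u, v) -> G (u *+ n, v *+ n).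
  by move=> Guv; elim: n => [|n IH]; rewrite ?mulr0n // !mulrS; apply: GD.
by move=> h i; rewrite !coef_deriv; apply: GMn.
Qed.

Let Gp0 q : Gp 0 q -> q = 0.
Proof.
case: G_der => _ _ _ G0 h; apply/polyP => i; rewrite coef0.
by apply: G0; have := h i; rewrite coef0.
Qed.

(* If theta is algebraic over the subring, its minimal equation forces the
   value of the derivation at theta; otherwise any value will do. *)
Lemma partial_derivation_value : exists delta, forall p q, Gp p q ->
  p.[theta] = 0 -> q.[theta] + delta * p^`().[theta] = 0.
Proof.
pose alg m := `[< exists p q,
  [/\ Gp p q, p != 0, p.[theta] = 0 & size p = m] >].
have [exalg|noalg] := pselect (exists m, alg m); last first.
  exists 0 => p q pq p0; have [pz|pnz] := eqVneq p 0.
    by rewrite pz in pq *; rewrite (Gp0 pq) horner0 mul0r addr0.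
  by case: noalg; exists (size p); apply/asboolP; exists p, q.
case: (ex_minnP exalg) => m /asboolP[p [q [pq pnz p0 ep]]] min_m.
have {}min_m f g : Gp f g -> f.[theta] = 0 -> (size f < size p)%N -> f = 0.
  move=> fg f0 lt_f; apply/eqP/contraT => fnz.
  have := min_m (size f); rewrite leqNgt -ep lt_f; apply.
  by apply/asboolP; exists f, g.
have sp : (1 < size p)%N.
  by apply: (root_size_gt1 (a := theta)) => //; apply/rootP.
(* By minimality of [p], a zero of its derivative at [theta] would make the derivative vanish
   identically, which characteristic zero excludes. *)
have p'nz : p^`().[theta] != 0.
  apply/eqP => /(min_m _ _ (Gpderiv pq)) p'0.
  have := p'0 (lt_size_deriv pnz).
  move=> /(congr1 (fun f : {poly L} => f`_(size p).-2)).
  rewrite coef_deriv coef0; case: (size p) (sp) (lead_coefE p) => [|[|s]] //= _ lE.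
  rewrite -lE -mulr_natr => /eqP; rewrite mulf_eq0 (negbTE (char0 s)).
  by rewrite lead_coef_eq0 (negbTE pnz).
pose delta := - q.[theta] / p^`().[theta].
have pdelta : q.[theta] + delta * p^`().[theta] = 0.
  by rewrite /delta divfK // subrr.
exists delta => f g fg f0.
have [n le_n] := ubnP (size f); elim: n => // n IH in f g fg f0 le_n *.
have [lt_fp|le_pf] := ltnP (size f) (size p).
  have fz := min_m f g fg f0 lt_fp; rewrite fz in fg *.
  by rewrite (Gp0 fg) deriv0 !horner0 mulr0 addr0.
(* One step of pseudo-division: r = a f - b X^k p cancels the leading term without dividing by [a],
   which need not be invertible in the subring. *)
set k := (size f - size p)%N; pose a := lead_coef p; pose a' := q`_(size p).-1.
pose b := lead_coef f; pose b' := g`_(size f).-1.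
have anz : a != 0 by rewrite lead_coef_eq0.
have Ga : Gp a%:P a'%:P by apply: GpC; apply: pq.
have Gb : Gp b%:P b'%:P by apply: GpC; apply: fg.
have Gr := GpB (GpM Ga fg) (GpM Gb (GpM (GpXn k) pq)).
set r := (X in Gp X _) in Gr; set r' := (X in Gp _ X) in Gr.
have r0 : r.[theta] = 0 by rewrite /r hornerD hornerN !hornerM f0 p0 !mulr0 subr0.
have sr : (size r < size f)%N.
  have fnz : f != 0 by rewrite -size_poly_gt0 (leq_trans _ le_pf) // ltnW.
  have bnz : b != 0 by rewrite lead_coef_eq0.
  have s1 : size (a%:P * f) = size f by rewrite size_Cmul.
  have s2 : size (b%:P * ('X^k * p)) = size f.
    by rewrite size_Cmul // mulrC size_mulXn // subnK.
  rewrite -(prednK (n := size f)) ?size_poly_gt0 // ltnS; apply/leq_sizeP => j.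
  rewrite leq_eqVlt => /predU1P[<-|lt_j]; last first.
    by rewrite prednK ?size_poly_gt0 // in lt_j;
      rewrite coefB !nth_default ?s1 ?s2 ?subr0.
  rewrite coefB -{1}s1 -{1}s2 -!lead_coefE !lead_coefM !lead_coefC lead_coefXn.
  by rewrite mul1r mulrC subrr.
have := IH r r' Gr r0 (leq_trans sr le_n).
have -> : r'.[theta] = a * g.[theta] - b * theta ^+ k * q.[theta].
  rewrite /r' !(hornerD, hornerN, hornerM, hornerC, hornerXn, horner0) f0 p0; ring.
have -> : r^`().[theta] = a * f^`().[theta] - b * theta ^+ k * p^`().[theta].
  rewrite /r derivB !derivM !derivC !mul0r !add0r.
  rewrite !(hornerD, hornerN, hornerM, hornerC, hornerXn, horner0) p0; ring.
move=> e; apply: (mulfI anz); rewrite mulr0.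
have -> : a * (g.[theta] + delta * f^`().[theta]) =
  b * theta ^+ k * (q.[theta] + delta * p^`().[theta]).
  by apply/eqP; rewrite -subr_eq0 -[X in _ == X]e; apply/eqP; ring.
by rewrite pdelta mulr0.
Qed.

(** The chain rule dictates the value q(theta) + delta p'(theta) at p(theta);
    [partial_derivation_value] makes this single-valued. *)
Lemma partial_derivation_adjoin : exists2 G', partial_derivation G' &
  G `<=` G' /\ exists delta, G' (theta, delta).
Proof.
have [delta dP] := partial_derivation_value.
exists [set w | exists p q, Gp p q /\
    w = (p.[theta], q.[theta] + delta * p^`().[theta])].
  split.
  - exists 1, 0; split; first by case: G_der => G1 _ _ _; apply: GpC.
    by rewrite derivC hornerC !horner0 mulr0 addr0.
  - move=> _ _ _ _ [p [q [pq [-> ->]]]] [p' [q' [pq' [-> ->]]]].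
    exists (p - p'), (q - q'); split; first exact: GpB.
    by rewrite derivB !hornerE; congr (_, _); ring.
  - move=> _ _ _ _ [p [q [pq [-> ->]]]] [p' [q' [pq' [-> ->]]]].
    exists (p * p'), (p * q' + q * p'); split; first exact: GpM.
    by rewrite derivM !hornerE; congr (_, _); ring.
  - by move=> v [p [q [pq [p0 ->]]]]; apply: dP.
split.
  move=> [u v] Guv; exists u%:P, v%:P; split; first exact: GpC.
  by rewrite derivC !hornerC mulr0 addr0.
by exists delta, 'X, 0; split=> //; rewrite derivX hornerX horner0 hornerC mulr1 add0r.
Qed.

End Adjoin.

Lemma derivation_extension (G : set (L * L)) : partial_derivation G ->
  exists D, derivation D /\ forall u v, G (u, v) -> D u = v.
Proof.
move=> G_der.
pose P (A : set (L * L)) := A = set0 \/ (partial_derivation A /\ G `<=` A).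
have [|A [PA Amax]] := @Zorn_bigcup _ P.
  move=> F FP Ftot.
  have [F0|] := pselect (forall X, F X -> X = set0).
    by left; apply/seteqP; split=> // x [X FX]; rewrite (F0 X FX).
  move=> /existsNP[X /not_implyP[FX Xn0]]; right.
  have good Y : F Y -> Y !=set0 -> partial_derivation Y /\ G `<=` Y.
    by move=> FY [y Yy]; case: (FP Y FY) => // Y0; rewrite Y0 in Yy.
  have both y z : (\bigcup_(Y in F) Y) y -> (\bigcup_(Y in F) Y) z ->
      exists Y, [/\ F Y, partial_derivation Y, Y y & Y z].
    move=> [Y FY Yy] [Z FZ Zz].
    have [YZ|ZY] := Ftot Y Z FY FZ.
    - by exists Z; split=> //; [case: (good Z FZ)|]; [exists z| |apply: YZ].
    - by exists Y; split=> //; [case: (good Y FY)|]; [exists y| |apply: ZY].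
  have [X_der GX] : partial_derivation X /\ G `<=` X.
    by apply: good => //; apply/set0P/eqP.
  split; last by move=> w Gw; exists X => //; apply: GX.
  split.
  - by exists X => //; case: X_der.
  - move=> u v u' v' h h'; have [Y [FY [_ YB _ _] y z]] := both _ _ h h'.
    by exists Y => //; apply: YB.
  - move=> u v u' v' h h'; have [Y [FY [_ _ YM _] y z]] := both _ _ h h'.
    by exists Y => //; apply: YM.
  - by move=> v h; have [Y [FY [_ _ _ Y0] y _]] := both _ _ h h; apply: Y0.
have [A_der GA] : partial_derivation A /\ G `<=` A.
  case: PA => // A0; case: (Amax G); last by right; split.
  rewrite A0 properEneq; split=> //; apply/eqP => e.
  by case: G_der; rewrite -e.
have A_tot u : exists v, A (u, v).
  have [B B_der [AB [v Buv]]] := partial_derivation_adjoin A_der u.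
  have [BA|nBA] := pselect (B `<=` A); first by exists v; apply: BA.
  by case: (Amax B); [split|right; split=> //; apply: subset_trans AB].
have [D DP] := choice A_tot.
have A_fun u v : A (u, v) -> D u = v.
  case: A_der => _ AB _ A0 h; apply/eqP; rewrite -subr_eq0; apply/eqP/A0.
  by have := AB _ _ _ _ (DP u) h; rewrite subrr.
case: (A_der) => A1 AB AM A0.
have DB u v : D (u - v) = D u - D v by apply: A_fun; apply: AB.
have D0 : D 0 = 0 by rewrite -[X in D X](subrr 0) DB subrr.
exists D; split; last by move=> u v /GA; apply: A_fun.
split=> u v; last by apply: A_fun; apply: AM.
by rewrite -[v in LHS]opprK DB -[- v]sub0r DB D0 sub0r opprK.
Qed.

End Derivations.

(** * Hilbert's Nullstellensatz *)

Lemma mpoly_ring_ind (R : comNzRingType) n (P : {mpoly R[n]} -> Prop) :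
  (forall c, P c%:MP) -> (forall i, P 'X_i) ->
  (forall p q, P p -> P q -> P (p + q)) ->
  (forall p q, P p -> P q -> P (p * q)) -> forall p, P p.
Proof.
move=> PC PX PD PM p.
have P1 : P 1 by rewrite -mpolyC1; apply: PC.
have PXn i k : P ('X_i ^+ k).
  by elim: k => [|k IH]; rewrite ?expr0 // exprS; apply: (PM).
rewrite [p]mpolyE; apply: (big_ind P) => [|p1 p2|m _]; [by rewrite -mpolyC0|exact: PD|].
rewrite -mul_mpolyC; apply: (PM); first exact: PC.
rewrite mpolyXE_id; apply: (big_ind P); [exact: P1|exact: PM|move=> i _].
exact: PXn.
Qed.

Section PointExtension.
Variables (K : closedFieldType) (L : fieldType) (iota : {rmorphism K -> L}).

Definition subalgebra (B : set L) : Prop :=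
  [/\ forall c, B (iota c), forall u v, B u -> B v -> B (u - v) &
      forall u v, B u -> B v -> B (u * v)].

(* The graph of a K-algebra morphism to K from a K-subalgebra of L. *)
Definition partial_point (G : set (L * K)) : Prop :=
  [/\ forall c, G (iota c, c),
      forall u v u' v', G (u, v) -> G (u', v') -> G (u - u', v - v'),
      forall u v u' v', G (u, v) -> G (u', v') -> G (u * u', v * v') &
      forall v, G (0, v) -> v = 0].

(** Density of the [K]-points of [B]. Asking for a point off every nonzero element, and not just for
    one point, gives a property that survives adjoining a generator. *)
Definition many_points (B : set L) : Prop := forall b, B b -> b != 0 ->
  exists G, [/\ partial_point G, forall u, B u -> exists v, G (u, v) &
                exists2 v, G (b, v) & v != 0].

Definition adjoin (B : set L) (theta : L) : set L :=
  [set u | exists2 p : {poly L}, (forall i, B p`_i) & u = p.[theta]].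

Lemma subalgebra0 B : subalgebra B -> B 0.
Proof. by case=> BC _ _; rewrite -(rmorph0 iota). Qed.

Lemma subalgebra1 B : subalgebra B -> B 1.
Proof. by case=> BC _ _; rewrite -(rmorph1 iota). Qed.

Lemma subalgebraD B u v : subalgebra B -> B u -> B v -> B (u + v).
Proof.
move=> hB Bu Bv; have B0 := subalgebra0 hB; case: hB => _ BB _.
by rewrite -[v]opprK; apply: (BB) => //; rewrite -sub0r; apply: (BB).
Qed.

Lemma subalgebra_sum B (I : Type) (r : seq I) (F : I -> L) :
  subalgebra B -> (forall i, B (F i)) -> B (\sum_(i <- r) F i).
Proof.
move=> hB BF; apply: (big_ind B) => //; first exact: subalgebra0.
by move=> u v; apply: subalgebraD.
Qed.

Section Poly.
Variables (B : set L) (hB : subalgebra B).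
Local Notation Bp p := (forall i, B p`_i).

Lemma subalgebra_polyB (p q : {poly L}) : Bp p -> Bp q -> Bp (p - q).
Proof. by case: hB => _ BB _ hp hq i; rewrite coefB; apply: (BB). Qed.

Lemma subalgebra_polyD (p q : {poly L}) : Bp p -> Bp q -> Bp (p + q).
Proof. by move=> hp hq i; rewrite coefD; apply: subalgebraD. Qed.

Lemma subalgebra_polyM (p q : {poly L}) : Bp p -> Bp q -> Bp (p * q).
Proof.
case: (hB) => _ _ BM hp hq i; rewrite coefM; apply: subalgebra_sum => // j.
exact: BM.
Qed.

Lemma subalgebra_polyC c : B c -> Bp c%:P.
Proof. by move=> Bc i; rewrite coefC; case: eqP => // _; apply: subalgebra0. Qed.

Lemma subalgebra_polyXn k : Bp ('X^k : {poly L}).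
Proof.
by move=> i; rewrite coefXn; case: eqP => _;
  [apply: subalgebra1|apply: subalgebra0].
Qed.

Lemma subalgebra_polyXM (p : {poly L}) k : Bp p -> Bp (p * 'X^k).
Proof. by move=> hp; apply: subalgebra_polyM => //; apply: subalgebra_polyXn. Qed.

Lemma subalgebra_pseudo_division (f p : {poly L}) : Bp f -> Bp p -> p != 0 ->
  exists k (q r : {poly L}), [/\ Bp q, Bp r, (size r < size p)%N &
                    (lead_coef p ^+ k)%:P * f = q * p + r].
Proof.
move=> Bf Bp' pnz; have [n le_n] := ubnP (size f).
elim: n => // n IH in f Bf le_n *.
have [lt_fp|le_pf] := ltnP (size f) (size p).
  exists 0%N, 0, f; split=> //; last by rewrite expr0 mul1r mul0r add0r.
  by move=> i; rewrite coef0; apply: subalgebra0.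
set a := lead_coef p; set b := lead_coef f; set k := (size f - size p)%N.
have fnz : f != 0 by rewrite -size_poly_gt0 (leq_trans _ le_pf) // size_poly_gt0.
have [anz bnz] : a != 0 /\ b != 0 by rewrite !lead_coef_eq0.
have Ba : B a by apply: Bp'.
have Bb : B b by apply: Bf.
pose g := a%:P * f - b%:P * (p * 'X^k).
have Bg : Bp g.
  apply: subalgebra_polyB; apply: subalgebra_polyM => //; try exact: subalgebra_polyC.
  exact: subalgebra_polyXM.
have s1 : size (a%:P * f) = size f by rewrite size_Cmul.
have s2 : size (b%:P * (p * 'X^k)) = size f.
  by rewrite size_Cmul // size_mulXn // subnK.
have sg : (size g < size f)%N.
  rewrite -(prednK (n := size f)) ?size_poly_gt0 // ltnS; apply/leq_sizeP => j.
  rewrite leq_eqVlt => /predU1P[<-|lt_j]; last first.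
    by rewrite prednK ?size_poly_gt0 // in lt_j;
      rewrite coefB !nth_default ?s1 ?s2 ?subr0.
  rewrite coefB -{1}s1 -{1}s2 -!lead_coefE !lead_coefM !lead_coefC lead_coefXn.
  by rewrite mulr1 mulrC subrr.
have [l [q [r [Bq Br lt_r e]]]] := IH g Bg (leq_trans sg le_n).
have Bal : B (a ^+ l).
  case: (hB) => _ _ BM; elim: (l) => [|j IHj]; first exact: subalgebra1.
  by rewrite exprS; apply: (BM).
exists l.+1, (q + (a ^+ l)%:P * (b%:P * 'X^k)), r; split=> //.
  apply: subalgebra_polyD => //; apply: subalgebra_polyM.
    exact: subalgebra_polyC.
  by apply: subalgebra_polyXM; apply: subalgebra_polyC.
rewrite mulrDl addrAC -e exprSr polyCM /g; ring.
Qed.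

Lemma adjoin_subalgebra theta : subalgebra (adjoin B theta).
Proof.
split.
- move=> c; exists (iota c)%:P; last by rewrite hornerC.
  by apply: subalgebra_polyC; case: hB.
- move=> _ _ [p Bp' ->] [q Bq ->]; exists (p - q); last by rewrite hornerD hornerN.
  exact: subalgebra_polyB.
- move=> _ _ [p Bp' ->] [q Bq ->]; exists (p * q); last by rewrite hornerM.
  exact: subalgebra_polyM.
Qed.

Lemma adjoinS theta : B `<=` adjoin B theta.
Proof. by move=> u Bu; exists u%:P; [apply: subalgebra_polyC|rewrite hornerC]. Qed.

Lemma adjoin_gen theta : adjoin B theta theta.
Proof.
exists 'X; last by rewrite hornerX.
by rewrite -['X]expr1; apply: subalgebra_polyXn.
Qed.

End Poly.

Section Lifting.
Variables (B : set L) (hB : subalgebra B) (G : set (L * K)).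
Hypotheses (hG : partial_point G) (GB : forall u, B u -> exists v, G (u, v)).
Local Notation Bp p := (forall i, B p`_i).
Local Notation Gp p q := (forall i, G (p`_i, q`_i)).

Lemma partial_point_fun u v v' : G (u, v) -> G (u, v') -> v = v'.
Proof.
case: hG => _ GS _ G0 h h'; apply/eqP; rewrite -subr_eq0; apply/eqP/G0.
by have := GS _ _ _ _ h h'; rewrite subrr.
Qed.

Lemma partial_point_lift (p : {poly L}) : Bp p -> exists q : {poly K}, Gp p q.
Proof.
move=> Bp'; have [c Gc] := choice (fun i => GB (Bp' i)).
exists (\poly_(i < size p) c i) => i; rewrite coef_poly; case: ltnP => // le_p.
by rewrite nth_default //; case: hG => /(_ 0); rewrite rmorph0.
Qed.

Lemma partial_point_polyB (p p' : {poly L}) (q q' : {poly K}) :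
  Gp p q -> Gp p' q' -> Gp (p - p') (q - q').
Proof. by case: hG => _ GS _ _ h h' i; rewrite !coefB; apply: (GS). Qed.

Lemma partial_point_polyM (p p' : {poly L}) (q q' : {poly K}) :
  Gp p q -> Gp p' q' -> Gp (p * p') (q * q').
Proof.
case: (hG) => GC GS GM _ h h' i; rewrite !coefM.
have G0 : G (0, 0) by have := GC 0; rewrite rmorph0.
have GD u v u' v' : G (u, v) -> G (u', v') -> G (u + u', v + v').
  move=> g g'; have := GS _ _ _ _ g (GS _ _ _ _ G0 g').
  by rewrite !sub0r !opprK.
apply: (big_ind2 (fun u v => G (u, v))) => // j _; exact: GM.
Qed.

Lemma partial_point_polyC u v : G (u, v) -> Gp u%:P v%:P.
Proof.
move=> h i; rewrite !coefC; case: eqP => // _.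
by case: hG => /(_ 0); rewrite rmorph0.
Qed.

Lemma partial_point_poly0 (q : {poly K}) : Gp (0 : {poly L}) q -> q = 0.
Proof.
case: hG => _ _ _ G0 h; apply/polyP => i; rewrite coef0.
by apply: G0; have := h i; rewrite coef0.
Qed.

Lemma partial_point_adjoin theta xi :
  (forall (p : {poly L}) (q : {poly K}), Bp p -> Gp p q ->
     p.[theta] = 0 -> q.[xi] = 0) ->
  exists G', [/\ partial_point G',
    forall (p : {poly L}) (q : {poly K}), Bp p -> Gp p q ->
      G' (p.[theta], q.[xi]) &
    forall u, adjoin B theta u -> exists v, G' (u, v)].
Proof.
move=> well; exists [set w | exists (p : {poly L}) (q : {poly K}),
  [/\ Bp p, Gp p q & w = (p.[theta], q.[xi])]].
split.
- split.
  + move=> c; exists (iota c)%:P, c%:P; rewrite !hornerC; split=> //.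
      by apply: subalgebra_polyC => //; case: hB.
    by apply: partial_point_polyC; case: hG.
  + move=> _ _ _ _ [p [q [hp hq [-> ->]]]] [p' [q' [hp' hq' [-> ->]]]].
    exists (p - p'), (q - q'); rewrite !hornerD !hornerN; split=> //.
      exact: subalgebra_polyB.
    exact: partial_point_polyB.
  + move=> _ _ _ _ [p [q [hp hq [-> ->]]]] [p' [q' [hp' hq' [-> ->]]]].
    exists (p * p'), (q * q'); rewrite !hornerM; split=> //.
      exact: subalgebra_polyM.
    exact: partial_point_polyM.
  + by move=> v [p [q [hp hq [p0 ->]]]]; apply: well hp hq _.
- by move=> p q hp hq; exists p, q.
- move=> _ [p hp ->]; have [q hq] := partial_point_lift hp.
  by exists q.[xi], p, q.
Qed.

End Lifting.

(** If [theta] is transcendental over [B], keep one coefficient of the element nonzero and choose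
    [xi] off the roots of the specialised polynomial. If [theta] is algebraic with minimal equation
    [p], choose a point of [B] where the leading coefficient of [p] and a nonzero multiple of the
    element lying in [B] both survive, and take for [xi] a root of the specialised [p]. *)
Lemma many_points_adjoin B theta :
  subalgebra B -> many_points B -> many_points (adjoin B theta).
Proof.
move=> hB mB _ [p0 Bp0 ->] p0nz.
pose Bp (p : {poly L}) := forall i, B p`_i.
have [exalg|noalg] := pselect (exists p : {poly L}, [/\ Bp p, p != 0 & p.[theta] = 0]); last first.
  have {}noalg p : Bp p -> p.[theta] = 0 -> p = 0.
    by move=> hp p_0; apply/eqP/contraT => pnz; case: noalg; exists p.
  have [i cnz] : exists i, p0`_i != 0.
    exists (size p0).-1; rewrite -lead_coefE lead_coef_eq0.
    by apply: contraNneq p0nz => ->; rewrite horner0.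
  have [G [hG GB [v Gv vnz]]] := mB _ (Bp0 i) cnz.
  have [q0 Gq0] := partial_point_lift hG GB Bp0.
  have q0nz : q0 != 0.
    apply: contraNneq vnz => q00; have := Gq0 i; rewrite q00 coef0 => G0.
    exact/eqP/(partial_point_fun hG Gv G0).
  have /closed_nonrootP[xi /rootP/eqP xi_q0] := q0nz.
  have [|G' [hG' GE GA]] := partial_point_adjoin hB hG GB (theta := theta) (xi := xi).
    move=> p q hp Gpq p_0; have pz := noalg p hp p_0.
    by rewrite (@partial_point_poly0 G hG q) ?horner0 // => j; have := Gpq j; rewrite pz.
  by exists G'; split=> //; exists q0.[xi] => //; apply: GE.
pose alg m := `[< exists p : {poly L}, [/\ Bp p, p != 0, p.[theta] = 0 & size p = m] >].
have {}exalg : exists m, alg m.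
  by have [p [? ? ?]] := exalg; exists (size p); apply/asboolP; exists p.
case: (ex_minnP exalg) => m /asboolP[p [hp pnz p_0 ep]] min_m.
have {}min_m f : Bp f -> f.[theta] = 0 -> (size f < size p)%N -> f = 0.
  move=> hf f0 lt_f; apply/eqP/contraT => fnz.
  have := min_m (size f); rewrite leqNgt -ep lt_f; apply.
  by apply/asboolP; exists f.
have sp : (1 < size p)%N.
  by apply: (root_size_gt1 (a := theta)) => //; apply/rootP.
set c := lead_coef p; have cnz : c != 0 by rewrite lead_coef_eq0.
(* A nonzero multiple of the given element lies in B. *)
pose mult k := `[< exists r s : {poly L}, [/\ Bp r, Bp s, r.[theta] != 0,
  r.[theta] = p0.[theta] * s.[theta] & (size r < size p)%N /\ size r = k] >].
have Bexp k : B (c ^+ k).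
  case: (hB) => _ _ BM; elim: k => [|k IH]; first exact: subalgebra1.
  by rewrite exprS; apply: (BM) => //; apply: hp.
have exmult : exists k, mult k.
  have [k [q [r [Bq Br lt_r e]]]] := subalgebra_pseudo_division hB Bp0 hp pnz.
  have e' : r.[theta] = p0.[theta] * (c ^+ k)%:P.[theta].
    have := congr1 (fun f : {poly L} => f.[theta]) e.
    by rewrite hornerD !hornerM p_0 mulr0 add0r => <-; rewrite mulrC.
  exists (size r); apply/asboolP; exists r, (c ^+ k)%:P; split=> //.
    exact: subalgebra_polyC.
  by rewrite e' hornerC mulf_neq0 // expf_neq0.
case: (ex_minnP exmult) => k /asboolP[r [s [hr hs rnz rs [lt_r er]]]] min_k.
have rn0 : r != 0 by apply: contraNneq rnz => ->; rewrite horner0.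
(* Descent: were [r] not constant, dividing [p] by it would leave a remainder of smaller size, again
   a multiple of the element at [theta]. A remainder vanishing at [theta] would split [p] up to a
   constant, against its minimality. *)
have sr : size r = 1%N.
  apply/eqP; rewrite eqn_leq size_poly_gt0 rn0 andbT leqNgt; apply/negP => gt_r.
  have [l [q [t [Bq Bt lt_t e]]]] := subalgebra_pseudo_division hB hp hr rn0.
  have := congr1 (fun f : {poly L} => f.[theta]) e.
  rewrite hornerD !hornerM p_0 mulr0 => /esym/eqP; rewrite addrC addr_eq0 => /eqP et.
  have [tz|tnz] := eqVneq t.[theta] 0.
    have t0 := min_m t Bt tz (ltn_trans lt_t lt_r).
    move: et; rewrite tz => /esym/eqP.
    rewrite oppr_eq0 mulf_eq0 (negbTE rnz) orbF => /eqP q_0.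
    rewrite t0 addr0 in e.
    have lnz : lead_coef r ^+ l != 0 by rewrite expf_neq0 // lead_coef_eq0.
    have qn0 : q != 0.
      apply: contraNneq pnz => q0; move: e; rewrite q0 mul0r => /eqP.
      by rewrite mulf_eq0 polyC_eq0 (negbTE lnz).
    have lt_q : (size q < size p)%N.
      have := congr1 (fun f : {poly L} => size f) e.
      rewrite /= size_Cmul // size_mul // => ->.
      by rewrite -ltnS prednK ?addn_gt0 ?size_poly_gt0 ?qn0 // -addn2 leq_add2l.
    by rewrite (min_m q Bq q_0 lt_q) eqxx in qn0.
  have := min_k (size t); rewrite leqNgt -er lt_t => no_t.
  suff : false by []; apply: no_t; apply/asboolP; exists t, (- (q * s)); split=> //.
  - rewrite -sub0r; apply: subalgebra_polyB => //; last exact: subalgebra_polyM.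
    by move=> i; rewrite coef0; apply: subalgebra0.
  - by rewrite et rs hornerN hornerM; ring.
  - by split=> //; apply: ltn_trans lt_t lt_r.
have [b rb] : exists b, r = b%:P by exists r`_0; apply: size1_polyC; rewrite sr.
rewrite rb hornerC in rnz rs.
have Bb : B b by have := hr 0%N; rewrite rb coefC eqxx.
have [|G [hG GB [v Gv vnz]]] := mB (c * b) _ (mulf_neq0 cnz rnz).
  by case: hB => _ _ BM; apply: (BM) => //; apply: hp.
have [pt Gpt] := partial_point_lift hG GB hp.
have [w Gb] := GB b Bb.
have Gc : G (c, pt`_(size p).-1) by apply: Gpt.
set d := pt`_(size p).-1 in Gc.
have ev : v = d * w.
  by apply: (partial_point_fun hG Gv); case: hG => _ _ GM _; apply: (GM).
have [dnz wnz] : d != 0 /\ w != 0.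
  by move: vnz; rewrite ev mulf_eq0 => /norP[].
have /closed_rootP[xi /rootP pt_xi] : size pt != 1%N.
  rewrite gtn_eqF //; apply: leq_trans (sp) _; rewrite leqNgt; apply/negP => lt_pt.
  by move: dnz; rewrite /d nth_default ?eqxx // -ltnS prednK // (ltn_trans _ sp).
have [|G' [hG' GE GA]] := partial_point_adjoin hB hG GB (theta := theta) (xi := xi).
  (* A relation [f] of [theta] is, up to a power of [c], a multiple of [p]. Since [c] specialises to
     the nonzero [d], the relation specialises to one satisfied by [xi]. *)
  move=> f g hf Gfg f0.
  have [l [q [t [Bq Bt lt_t e]]]] := subalgebra_pseudo_division hB hf hp pnz.
  have t0 : t = 0.
    apply: min_m => //; have := congr1 (fun f : {poly L} => f.[theta]) e.
    by rewrite hornerD !hornerM f0 p_0 !mulr0 add0r => <-.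
  rewrite t0 addr0 in e.
  have [qt Gq] := partial_point_lift hG GB Bq.
  have [z Gz] := GB _ (Bexp l).
  have ez : z = d ^+ l.
    apply: (partial_point_fun hG Gz); case: hG => GC _ GM _.
    elim: (l) => [|j IH]; last by rewrite !exprS; apply: (GM).
    by have := GC 1; rewrite rmorph1.
  have := partial_point_polyB hG (partial_point_polyM hG (partial_point_polyC hG Gz) Gfg)
    (partial_point_polyM hG Gq Gpt).
  rewrite e subrr => /(partial_point_poly0 hG)/(congr1 (fun f : {poly K} => f.[xi])).
  rewrite horner0 hornerD hornerN !hornerM hornerC pt_xi mulr0 subr0 ez => /eqP.
  by rewrite mulf_eq0 expf_eq0 (negbTE dnz) andbF => /eqP.
have [x Gx] := GA p0.[theta] (ex_intro2 _ _ p0 Bp0 erefl).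
have [y Gy] := GA s.[theta] (ex_intro2 _ _ s hs erefl).
exists G'; split=> //; exists x => //.
have Gbw : G' (b, w).
  have := GE b%:P w%:P (subalgebra_polyC hB Bb) (partial_point_polyC hG Gb).
  by rewrite !hornerC.
apply: contraNneq wnz => x0; have := partial_point_fun hG' Gbw.
move=> /(_ (x * y)) ->; first by rewrite x0 mul0r.
by rewrite rs; case: hG' => _ _ GM _; apply: (GM).
Qed.

End PointExtension.

(** The classes of the variables are adjoined to [K] one at a time inside the residue field. A
    [K]-point of the resulting algebra off the class of [g] is a zero of [Q] off [g]. *)
Lemma prime_ideal_point (K : closedFieldType) m (Q : set {mpoly K[m]}) g :
  prime_ideal Q -> ~ Q g ->
  exists v : 'I_m -> K, (forall f, Q f -> f.@[v] = 0) /\ g.@[v] != 0.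
Proof.
move=> hQ Qg; have [L [ev [evQ _]]] := residue_fieldP hQ.
have [iota iotaE] : exists iota : {rmorphism K -> L}, forall c, ev c%:MP = iota c.
  by exists (ev \o @mpolyC m K).
have [B [hB mB Bxi]] : exists B : set L, [/\ subalgebra iota B, many_points iota B &
    forall i, B (ev 'X_i)].
  suff [B [hB mB Bxi]] : exists B : set L, [/\ subalgebra iota B, many_points iota B &
      forall i, i \in enum 'I_m -> B (ev 'X_i)].
    by exists B; split=> // i; apply: Bxi; rewrite mem_enum.
  elim: (enum 'I_m) => [|i s [B [hB mB Bxi]]].
    exists (range iota); split=> //.
    - split; first by move=> c; exists c.
        by move=> _ _ [c _ <-] [d _ <-]; exists (c - d); rewrite ?rmorphB.
      by move=> _ _ [c _ <-] [d _ <-]; exists (c * d); rewrite ?rmorphM.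
    - move=> _ [c _ <-] cnz; exists [set w | w.1 = iota w.2]; split.
      + split=> //=.
        * by move=> u v u' v' -> ->; rewrite rmorphB.
        * by move=> u v u' v' -> ->; rewrite rmorphM.
        * by move=> v /esym/eqP; rewrite fmorph_eq0 => /eqP.
      + by move=> _ [d _ <-]; exists d.
      + by exists c => //; apply: contraNneq cnz => ->; rewrite rmorph0.
  exists (adjoin B (ev 'X_i)); split.
  - exact: adjoin_subalgebra.
  - exact: many_points_adjoin.
  - move=> j; rewrite inE => /predU1P[->|/Bxi Bj]; first exact: adjoin_gen hB _.
    exact: adjoinS hB _ _ Bj.
have Bev f : B (ev f).
  elim/mpoly_ring_ind: f => // [c|p q Bp Bq|p q Bp Bq].
  - by case: hB => BC _ _; rewrite iotaE.
  - by rewrite rmorphD; apply: subalgebraD hB _ _.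
  - by rewrite rmorphM; case: hB => _ _; apply.
have gnz : ev g != 0 by apply/eqP => /evQ.
have [G [hG GB [w Gw wnz]]] := mB _ (Bev g) gnz.
have [v Gv] := choice (fun i => GB _ (Bxi i)).
have Gev f : G (ev f, f.@[v]).
  case: (hG) => GC GS GM _.
  elim/mpoly_ring_ind: f => [c|i|p q Gp Gq|p q Gp Gq].
  - by rewrite iotaE mevalC.
  - by rewrite mevalXU.
  - rewrite rmorphD mevalD -[ev q]opprK -[q.@[v]]opprK; apply: (GS) => //.
    rewrite -[- ev q]sub0r -[- q.@[v]]sub0r; apply: (GS) => //.
    by have := GC 0; rewrite rmorph0.
  - by rewrite rmorphM mevalM; apply: GM.
exists v; split; last by rewrite (partial_point_fun hG (Gev g) Gw).
move=> f /evQ f0; have := Gev f; rewrite f0.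
by case: hG => _ _ _; apply.
Qed.

(** * Ideals, and primes avoiding the powers of an element *)

Definition ideal_generated (A : comNzRingType) (S : set A) : set A :=
  [set f | exists s : seq (A * A), (forall ab, ab \in s -> S ab.2) /\
                                   f = \sum_(ab <- s) ab.1 * ab.2].

Section IdealGenerated.
Variable A : comNzRingType.
Implicit Type S : set A.

Lemma ideal_generated0 S : ideal_generated S 0.
Proof. by exists [::]; rewrite big_nil. Qed.

Lemma ideal_generated_mem S f : S f -> ideal_generated S f.
Proof.
move=> Sf; exists [:: (1, f)]; rewrite big_seq1 mul1r; split=> //.
by move=> ab; rewrite inE => /eqP->.
Qed.

Lemma ideal_generated_lin S a f g :
  ideal_generated S f -> ideal_generated S g -> ideal_generated S (a * f + g).
Proof.
move=> [s [Ss ->]] [t [St ->]]; exists ([seq (a * x.1, x.2) | x <- s] ++ t).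
split.
  by move=> ab; rewrite mem_cat => /orP[/mapP[x /Ss Sx ->]|/St].
rewrite big_cat big_map mulr_sumr; congr (_ + _).
by apply: eq_bigr => x _; rewrite mulrA.
Qed.

(** An ideal maximal among those missing all powers of [g] is prime: each element outside it
    generates with it some power of [g], so if the product of two such elements were inside, a power
    of [g] would be too. *)
Lemma prime_ideal_avoiding S g : (forall M, ~ ideal_generated S (g ^+ M)) ->
  exists Q : set A, [/\ prime_ideal Q, S `<=` Q & ~ Q g].
Proof.
move=> noM.
pose ideal (I : set A) := I 0 /\ forall a x y, I x -> I y -> I (a * x + y).
pose good (I : set A) :=
  [/\ ideal I, ideal_generated S `<=` I & forall M, ~ I (g ^+ M)].
have goodS : good (ideal_generated S).
  split=> //; split; first exact: ideal_generated0.
  by move=> a x y; apply: ideal_generated_lin.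
have [|Q [PQ Qmax]] := @Zorn_bigcup _ (fun I : set A => I = set0 \/ good I).
  move=> F FP Ftot.
  have [F0|] := pselect (forall X, F X -> X = set0).
    by left; apply/seteqP; split=> // x [X FX]; rewrite (F0 X FX).
  move=> /existsNP[X /not_implyP[FX Xn0]]; right.
  have gd Y : F Y -> Y !=set0 -> good Y.
    by move=> FY [y Yy]; case: (FP Y FY) => // Y0; rewrite Y0 in Yy.
  have gX : good X by apply: gd => //; apply/set0P/eqP.
  split; last 1 first.
  - by move=> M [Y FY YM]; have [_ _] := gd Y FY (ex_intro _ _ YM); apply; apply: YM.
  - split; first by exists X => //; case: gX => -[].
    move=> a x y [Y FY Yx] [Z FZ Zy]; have [YZ|ZY] := Ftot Y Z FY FZ.
      exists Z => //; have [[_ ZM] _ _] := gd Z FZ (ex_intro _ _ Zy).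
      by apply: ZM => //; apply: YZ.
    exists Y => //; have [[_ YM] _ _] := gd Y FY (ex_intro _ _ Yx).
    by apply: YM => //; apply: ZY.
  - by move=> x Sx; exists X => //; case: gX => _ + _; apply.
have gQ : good Q.
  case: PQ => // Q0; case: (Qmax (ideal_generated S)); last by right.
  rewrite Q0 properEneq; split=> //; apply/eqP => e.
  by have := ideal_generated0 S; rewrite -e.
case: gQ => -[Q0 QM] SQ Qg.
have step x : ~ Q x -> exists M a q, Q q /\ g ^+ M = a * x + q.
  move=> Qx; apply: contrapT => noxM.
  case: (Qmax [set z | exists a q, Q q /\ z = a * x + q]).
    split; first by move=> q Qq; exists 0, q; rewrite mul0r add0r.
    move=> h; apply: Qx; apply: h; exists 1, 0; split=> //.
    by rewrite mul1r addr0.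
  right; split.
  - split; first by exists 0, 0; rewrite mul0r addr0.
    move=> c _ _ [a [q [Qq ->]]] [b [r [Qr ->]]].
    exists (c * a + b), (c * q + r); split; first exact: QM.
    ring.
  - by move=> q /SQ Qq; exists 0, q; rewrite mul0r add0r.
  - by move=> M [a [q [Qq e]]]; apply: noxM; exists M, a, q.
exists Q; split.
- split=> //; first by move=> Q1; apply: (Qg 0%N); rewrite expr0.
  move=> x y Qxy; apply: contrapT => /not_orP[/step[M [a [q [Qq ea]]]]].
  move=> /step[M' [b [r [Qr eb]]]]; apply: (Qg (M + M')%N).
  rewrite exprD ea eb.
  have -> : (a * x + q) * (b * y + r) =
    (a * b) * (x * y) + ((b * y + r) * q + ((a * x) * r + 0)) by ring.
  by apply: (QM) => //; apply: (QM) => //; apply: (QM).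
- by move=> f Sf; apply: SQ; apply: ideal_generated_mem.
- by move=> h; apply: (Qg 1%N).
Qed.

End IdealGenerated.

Lemma nullstellensatz (K : closedFieldType) m (S : set {mpoly K[m]}) g :
  (forall v : 'I_m -> K, (forall f, S f -> f.@[v] = 0) -> g.@[v] = 0) ->
  exists M, ideal_generated S (g ^+ M).
Proof.
move=> gS; apply: contrapT => /forallNP/prime_ideal_avoiding[Q [hQ SQ Qg]].
have [v [Qv gv]] := prime_ideal_point hQ Qg.
by move: gv; rewrite gS ?eqxx // => f /SQ/Qv.
Qed.

(** * Irreducible sets, chains and generic points *)

Lemma mmapXU n (R : nzRingType) (S : nzRingType) (f : {rmorphism R -> S})
  (h : 'I_n -> S) i : mmap f h 'X_i = h i.
Proof. by rewrite mmapX mmap1U. Qed.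

Lemma mpoly_rmorph_ext (R : comNzRingType) (S : nzRingType) n
    (phi psi : {rmorphism {mpoly R[n]} -> S}) :
  (forall c, phi c%:MP = psi c%:MP) -> (forall i, phi 'X_i = psi 'X_i) ->
  phi =1 psi.
Proof.
move=> eC eX; elim/mpoly_ring_ind => // p q ep eq.
  by rewrite !rmorphD ep eq.
by rewrite !rmorphM ep eq.
Qed.

Lemma mmap_comp (R S T : comNzRingType) m n (f : {rmorphism R -> S})
    (g : {rmorphism S -> T}) (F : 'I_n -> {mpoly R[m]}) (h : 'I_m -> S)
    (phi : {rmorphism {mpoly R[m]} -> S}) (P : {mpoly R[n]}) :
  (forall c, phi c%:MP = f c) ->
  phi (mmap (@mpolyC m R) F P) = mmap f (fun i => phi (F i)) P.
Proof.
move=> phiC.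
apply: (@mpoly_rmorph_ext R S n (phi \o mmap (@mpolyC m R) F)) => [c|i] /=.
  by rewrite !mmapC phiC.
by rewrite !mmapXU.
Qed.

Lemma meval_subst (R : comNzRingType) m n (F : 'I_n -> {mpoly R[m]}) v P :
  (mmap (@mpolyC m R) F P).@[v] = P.@[fun i => (F i).@[v]].
Proof. by apply: (@mmap_comp R R R m n idfun idfun) => // c; exact: mevalC. Qed.

Lemma mmap_subst (R S : comNzRingType) m n (f : {rmorphism R -> S})
    (F : 'I_n -> {mpoly R[m]}) h P :
  mmap f h (mmap (@mpolyC m R) F P) = mmap f (fun i => mmap f h (F i)) P.
Proof. by apply: (@mmap_comp R S S m n f idfun) => // c; exact: mmapC. Qed.

Section SplitLast.
Variables (R : idomainType) (n : nat).

Definition mpoly_split_last : {mpoly R[n.+1]} -> {poly {mpoly R[n]}} :=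
  mmap ((polyC \o @mpolyC n R) : {rmorphism R -> {poly {mpoly R[n]}}})
    (fun i => if unlift ord_max i is Some j then ('X_j)%:P else 'X).

HB.instance Definition _ := GRing.RMorphism.on mpoly_split_last.

Lemma mpoly_split_lastE (S : comNzRingType) (f : {rmorphism R -> S})
    (h : 'I_n.+1 -> S) P :
  mmap f h P =
    (map_poly (mmap f (fun j => h (lift ord_max j))) (mpoly_split_last P)).[h ord_max].
Proof.
pose g : {rmorphism {mpoly R[n]} -> S} := mmap f (fun j => h (lift ord_max j)).
apply: (@mpoly_rmorph_ext R S n.+1 (mmap f h)
  (horner_eval (h ord_max) \o map_poly g \o mpoly_split_last)) => [c|i] /=.
  have -> : mpoly_split_last c%:MP = c%:MP%:P.
    exact: (mmapC _ (polyC \o @mpolyC n R : {rmorphism R -> {poly {mpoly R[n]}}})).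
  by rewrite map_polyC /horner_eval hornerC /= /g /= !mmapC.
rewrite /= mmapXU /horner_eval.
have -> : mpoly_split_last 'X_i =
    if unlift ord_max i is Some j then ('X_j)%:P else 'X by apply: mmapXU.
case: unliftP => [j|] -> /=.
  by rewrite map_polyC hornerC /= /g /= mmapXU.
by rewrite map_polyX hornerX.
Qed.

Lemma mpoly_split_last_eq0 P : mpoly_split_last P = 0 -> P = 0.
Proof.
move=> P0; have := mpoly_split_lastE (@mpolyC n.+1 R) (fun i => 'X_i) P.
rewrite P0 map_poly0 horner0 => <-.
apply: (@mpoly_rmorph_ext R _ n.+1 idfun (mmap (@mpolyC n.+1 R) (fun i => 'X_i))).
  by move=> c; rewrite /= mmapC.
by move=> i; rewrite /= mmapXU.
Qed.

End SplitLast.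

Section PrimeSets.
Variable K : fieldType.

Definition nonvanishing m (F : {mpoly K[m]}) (S : set 'rV[K]_m) : Prop :=
  exists2 v, S v & F.@[v 0] != 0.

(* The closure of S is irreducible, i.e. its vanishing ideal is prime. *)
Definition prime_set m (S : set 'rV[K]_m) : Prop :=
  S !=set0 /\ forall F G, nonvanishing F S -> nonvanishing G S ->
    exists v, [/\ S v, F.@[v 0] != 0 & G.@[v 0] != 0].

(** Strictness is witnessed by a polynomial vanishing on the smaller set and not on the larger, so
    this is a chain of Zariski closures whose members need not be closed themselves. *)
Fixpoint has_chain m k (S : set 'rV[K]_m) : Prop :=
  prime_set S /\ if k is k'.+1 then
    exists S', [/\ S' `<=` S, has_chain k' S' &
      exists2 f, (forall v, S' v -> f.@[v 0] = 0) & nonvanishing f S]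
  else True.

Lemma has_chain_prime m k (S : set 'rV[K]_m) : has_chain k S -> prime_set S.
Proof. by case: k => [|k] []. Qed.

Lemma prime_setM m (S : set 'rV[K]_m) F G : prime_set S ->
  nonvanishing F S -> nonvanishing G S -> nonvanishing (F * G) S.
Proof.
move=> [_ SP] hF hG; have [v [Sv Fv Gv]] := SP F G hF hG.
by exists v => //; rewrite mevalM mulf_neq0.
Qed.

Lemma prime_set1 m (S : set 'rV[K]_m) : prime_set S -> nonvanishing 1 S.
Proof. by move=> [[v Sv] _]; exists v => //; rewrite meval1 oner_neq0. Qed.

Lemma prime_setX m (S : set 'rV[K]_m) F k : prime_set S ->
  nonvanishing F S -> nonvanishing (F ^+ k) S.
Proof.
move=> hS hF; elim: k => [|k IH]; first by rewrite expr0; apply: prime_set1.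
by rewrite exprS; apply: prime_setM.
Qed.

(** To the functions independent on S' add [g], which vanishes on S' and not on S. In a relation
    P(f, g) = 0 on S, factor out the largest power of the last variable; primality lets one cancel
    that power of [g], and restricting to S' leaves a nontrivial relation among the old
    functions. *)
Lemma chain_alg_independent m k (S : set 'rV[K]_m) : has_chain k S ->
  exists f : 'I_k -> {mpoly K[m]}, forall P : {mpoly K[k]},
    (forall v, S v -> P.@[fun i => (f i).@[v 0]] = 0) -> P = 0.
Proof.
elim: k S => [|k IH] S.
  move=> /has_chain_prime[[v Sv] _]; exists (fun _ => 0) => P /(_ v Sv).
  have [c ->] : exists c, P = c%:MP; last by rewrite mevalC => ->; rewrite mpolyC0.
  elim/mpoly_ring_ind: P => [c|[]|_ _ [c ->] [d ->]|_ _ [c ->] [d ->]] //.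
  - by exists c.
  - by exists (c + d); rewrite mpolyCD.
  - by exists (c * d); rewrite mpolyCM.
move=> [hS [S' [S'S /IH[f fP] [g gS' gS]]]].
pose F (i : 'I_k.+1) := if unlift ord_max i is Some j then f j else g.
have Fl : (fun j => F (lift ord_max j)) = f by apply/funext => j; rewrite /F liftK.
have Fm : F ord_max = g by rewrite /F unlift_none.
exists F => P; apply: contraPP => Pnz.
pose h : {rmorphism {mpoly K[k]} -> {mpoly K[m]}} := mmap (@mpolyC m K) f.
have q_nz : mpoly_split_last P != 0.
  by apply: contra_not_neq Pnz => /mpoly_split_last_eq0.
have [l [q /implyP/(_ q_nz) q0 eq]] := multiplicity_XsubC (mpoly_split_last P) 0.
have [v S'v qv] : exists2 v, S' v & (q.[0]).@[fun i => (f i).@[v 0]] != 0.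
  apply: contrapT => no_v; case/negP: q0; apply/rootP/fP => v S'v.
  by apply/eqP/contraT => nz; case: no_v; exists v.
have ePE : mmap (@mpolyC m K) F P = (map_poly h q).[g] * g ^+ l.
  rewrite mpoly_split_lastE Fl Fm eq subr0 -[mmap _ f]/(h : _ -> _).
  have -> : map_poly h (q * 'X^l) = map_poly h q * 'X^l.
    by rewrite (rmorphM (map_poly h)) /= map_polyXn.
  by rewrite hornerM hornerXn.
have [u Su] : nonvanishing ((map_poly h q).[g] * g ^+ l) S.
  apply: prime_setM => //; last exact: prime_setX.
  exists v; first exact: S'S.
  have -> : (map_poly h q).[g].@[v 0] = (h q.[0]).@[v 0].
    rewrite -!horner_map /= gS' // -!map_poly_comp; congr (_.[_]).
    by rewrite /= rmorph0 meval0.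
  by rewrite /h /= meval_subst.
by rewrite -ePE meval_subst => nz /(_ u Su)/eqP; apply/negP.
Qed.

End PrimeSets.

Lemma mderivXU (R : nzRingType) n (i j : 'I_n) :
  'X_i^`M(j) = ((i == j)%:R)%:MP :> {mpoly R[n]}.
Proof.
rewrite mderivX mnm1E; case: eqP => [->|_]; last by rewrite scale0r mpolyC0.
have -> : (U_(j) - U_(j) = 0)%MM by apply/mnmP => l; rewrite mnmBE subnn mnm0E.
by rewrite mpolyX0 scale1r.
Qed.

Section GenericPoint.
Variables (K : fieldType) (m : nat).
Implicit Types (S : set 'rV[K]_m) (F G : {mpoly K[m]}).

Lemma prime_set_ideal S :
  prime_set S -> prime_ideal [set F | forall v, S v -> F.@[v 0] = 0].
Proof.
move=> [[v Sv] SP]; split.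
- by move=> u _; rewrite meval0.
- by move=> /(_ v Sv)/eqP; rewrite meval1 oner_eq0.
- by move=> F G H /= hG hH u Su; rewrite mevalD mevalM hG ?hH // mulr0 addr0.
move=> F G /= FG; apply: contrapT => /not_orP[/existsNP[u /not_implyP[Su /eqP Fu]]].
move=> /existsNP[w /not_implyP[Sw /eqP Gw]].
have [|x [Sx Fx Gx]] := SP F G (ex_intro2 _ _ u Su Fu); first by exists w.
by have /eqP := FG x Sx; rewrite mevalM mulf_eq0 (negbTE Fx) (negbTE Gx).
Qed.

(** A generic point in the sense of Weil: its relations over [K] are exactly the equations of
    [S]. *)
Definition generic_point (L : fieldType) (iota : {rmorphism K -> L})
    (xi : 'rV[L]_m) S : Prop :=
  forall F, mmap iota (xi 0) F = 0 <-> forall v, S v -> F.@[v 0] = 0.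

Lemma generic_point_exists S : prime_set S ->
  exists (L : fieldType) (iota : {rmorphism K -> L}) (xi : 'rV[L]_m),
    generic_point iota xi S /\
    forall z, exists F G, mmap iota (xi 0) G != 0 /\
                          z = mmap iota (xi 0) F / mmap iota (xi 0) G.
Proof.
move=> /prime_set_ideal/residue_fieldP[L [ev [evS evQ]]].
pose iota : {rmorphism K -> L} := ev \o @mpolyC m K.
exists L, iota, (\row_i ev 'X_i).
have evE F : mmap iota ((\row_i ev 'X_i) 0) F = ev F.
  apply: (@mpoly_rmorph_ext K L m (mmap iota _) ev) => [c|i] /=.
    by rewrite mmapC.
  by rewrite mmapXU mxE.
split; first by move=> F; rewrite evE; apply: evS.
by move=> z; have [F [G [Gz ->]]] := evQ z; exists F, G; rewrite !evE.
Qed.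

Lemma generic_pointN (L : fieldType) (iota : {rmorphism K -> L}) xi S F :
  generic_point iota xi S -> mmap iota (xi 0) F != 0 <-> nonvanishing F S.
Proof.
move=> gen; split=> [/eqP nz|[v Sv Fv]].
  apply: contrapT => noF; apply/nz/gen => v Sv.
  by apply/eqP/contraT => Fv; case: noF; exists v.
by apply/eqP => /gen/(_ v Sv)/eqP; apply/negP.
Qed.

End GenericPoint.

Section DerivationTheory.
Variables (L : fieldType) (D : L -> L) (D_der : derivation D).

Lemma derivationD u v : D (u + v) = D u + D v.
Proof. by case: D_der. Qed.

Lemma derivationM u v : D (u * v) = u * D v + D u * v.
Proof. by case: D_der. Qed.

Lemma derivation0 : D 0 = 0.
Proof. by apply: (addrI (D 0)); rewrite -derivationD !addr0. Qed.

Lemma derivationN u : D (- u) = - D u.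
Proof. by apply/eqP; rewrite -addr_eq0 -derivationD addNr derivation0. Qed.

Lemma derivationB u v : D (u - v) = D u - D v.
Proof. by rewrite derivationD derivationN. Qed.

Lemma derivation1 : D 1 = 0.
Proof. by apply: (addrI (D 1)); rewrite addr0 -{3}[1]mulr1 derivationM mulr1 mul1r. Qed.

Lemma derivationV u : D u = 0 -> D u^-1 = 0.
Proof.
have [->|unz] := eqVneq u 0; first by rewrite invr0.
move=> Du; apply: (mulfI unz); rewrite mulr0; have := derivation1.
by rewrite -(divff unz) derivationM Du mul0r addr0.
Qed.

Lemma derivation_sum (I : Type) (r : seq I) (P : pred I) (F : I -> L) :
  D (\sum_(i <- r | P i) F i) = \sum_(i <- r | P i) D (F i).
Proof. by apply: (big_morph D derivationD derivation0). Qed.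

Lemma derivation_mmap (K : fieldType) (iota : {rmorphism K -> L}) n
    (h : 'I_n -> L) (F : {mpoly K[n]}) : (forall c, D (iota c) = 0) ->
  D (mmap iota h F) = \sum_i mmap iota h F^`M(i) * D (h i).
Proof.
move=> DK; elim/mpoly_ring_ind: F => [c|i|F G eF eG|F G eF eG].
- by rewrite mmapC DK big1 // => i _; rewrite mderivC mmap0 mul0r.
- rewrite mmapXU (bigD1 i) //= big1 ?addr0; last first.
    by move=> j ji; rewrite mderivXU eq_sym (negbTE ji) mmapC raddf0 mul0r.
  by rewrite mderivXU eqxx mmapC /= rmorph_nat mul1r.
- rewrite rmorphD derivationD eF eG; apply/esym.
  under eq_bigr => i _ do rewrite mderivD rmorphD mulrDl.
  exact: big_split.
- rewrite rmorphM derivationM eF eG [X in X + _]mulr_sumr [X in _ + X]mulr_suml; apply/esym.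
  transitivity (\sum_i (mmap iota h F * (mmap iota h G^`M(i) * D (h i)) +
    mmap iota h F^`M(i) * D (h i) * mmap iota h G)); last exact: big_split.
  apply: eq_bigr => i _.
  rewrite mderivM rmorphD !rmorphM /=; ring.
Qed.

End DerivationTheory.

(** The functions attached to the chain stay algebraically independent at the generic point, so the
    partial derivatives with respect to them are defined on the ring they generate; characteristic
    zero extends these to [L]. *)
Lemma chain_derivations (K L : fieldType) m s (S : set 'rV[K]_m)
    (iota : {rmorphism K -> L}) (xi : 'rV[L]_m) :
  (forall n, n.+1%:R != 0 :> L) -> generic_point iota xi S -> has_chain s S ->
  exists (f : 'I_s -> {mpoly K[m]}) (D : 'I_s -> L -> L),
    [/\ forall i, derivation (D i), forall i c, D i (iota c) = 0 &
        forall i j, D i (mmap iota (xi 0) (f j)) = (i == j)%:R].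
Proof.
move=> char0 gen /chain_alg_independent[f f_ind].
pose h i := mmap iota (xi 0) (f i).
have h0 P : mmap iota h P = 0 -> P = 0.
  rewrite -mmap_subst => /gen P0; apply: f_ind => v /P0.
  by rewrite meval_subst.
pose G i : set (L * L) :=
  [set w | exists P, w = (mmap iota h P, mmap iota h P^`M(i))].
have GP i : partial_derivation (G i).
  split.
  - by exists 1; rewrite -mpolyC1 mderivC mmapC /= rmorph1 mmap0.
  - move=> _ _ _ _ [P [-> ->]] [Q [-> ->]]; exists (P - Q).
    by rewrite mderivB !rmorphB.
  - move=> _ _ _ _ [P [-> ->]] [Q [-> ->]]; exists (P * Q).
    by rewrite mderivM rmorphD !rmorphM /= addrC.
  - by move=> v [P [/esym/h0 -> ->]]; rewrite mderiv0 mmap0.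
have [D DP] := choice (fun i => derivation_extension char0 (GP i)).
exists f, D; split; first by move=> i; case: (DP i).
  move=> i c; case: (DP i) => _; apply; exists c%:MP.
  by rewrite mmapC mderivC mmap0.
move=> i j; case: (DP i) => _; apply; exists 'X_j.
by rewrite mmapXU mderivXU mmapC /= rmorph_nat eq_sym.
Qed.

(** * Products, lines and linear spaces as links of chains *)

Section PrimeSetOperations.
Variable K : closedFieldType.

Lemma affine_substitution m n (A : 'M[K]_(n, m)) (b : 'rV[K]_m) (F : {mpoly K[m]}) :
  exists G : {mpoly K[n]}, forall v : 'rV_n, G.@[v 0] = F.@[(v *m A + b) 0].
Proof.
exists (mmap (@mpolyC n K) (fun i => \sum_j A j i *: 'X_j + (b 0 i)%:MP) F) => v.
rewrite meval_subst; apply: meval_eq => i; rewrite mevalD mevalC !mxE.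
rewrite raddf_sum; congr (_ + _); apply: eq_bigr => j _ /=.
by rewrite mevalZ mevalXU mulrC.
Qed.

Lemma prime_set_line m (w : 'rV[K]_m) : prime_set (range (fun t => t *: w)).
Proof.
split; first by exists 0, 0; rewrite ?scale0r.
pose P (F : {mpoly K[m]}) := mmap (@polyC K) (fun i => w 0 i *: 'X) F.
have PE F t : (P F).[t] = F.@[(t *: w) 0].
  apply: (@mpoly_rmorph_ext K K m
    (horner_eval t \o mmap (@polyC K) (fun i => w 0 i *: 'X)) (meval _)) => [c|i] /=.
    by rewrite mmapC mevalC /horner_eval hornerC.
  by rewrite mmapXU mevalXU /horner_eval hornerZ hornerX mxE mulrC.
have Pnz F : nonvanishing F (range (fun t => t *: w)) -> P F != 0.
  by move=> [_ [t _ <-]]; rewrite -PE; apply: contraNneq => ->; rewrite horner0.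
move=> F G /Pnz Fnz /Pnz Gnz.
have /closed_nonrootP[t] : P F * P G != 0 by rewrite mulf_neq0.
by rewrite rootM !rootE !PE => /norP[Ft Gt]; exists (t *: w).
Qed.

(** Choose [t] good for F at [s1] and for G at [s2] at once, then [s] good for both at this [t].
    Stated for linear images of a product so as to cover products and linear spaces alike. *)
Lemma prime_set_sum m n1 n2 (A : 'M[K]_(n1, m)) (B : 'M[K]_(n2, m)) S T :
  prime_set S -> prime_set T ->
  prime_set [set u | exists s t, [/\ S s, T t & u = s *m A + t *m B]].
Proof.
move=> [[s0 Ss0] SP] [[t0 Tt0] TP]; split; first by exists (s0 *m A + t0 *m B), s0, t0.
move=> F G [_ [s1 [t1 [Ss1 Tt1 ->]]] Fnz] [_ [s2 [t2 [Ss2 Tt2 ->]]] Gnz].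
have [F1 F1E] := affine_substitution B (s1 *m A) F.
have [G2 G2E] := affine_substitution B (s2 *m A) G.
have [||t [Tt Ft Gt]] := TP F1 G2.
- by exists t1; rewrite // F1E addrC.
- by exists t2; rewrite // G2E addrC.
have [F3 F3E] := affine_substitution A (t *m B) F.
have [G3 G3E] := affine_substitution A (t *m B) G.
have [||s [Ss Fs Gs]] := SP F3 G3.
- by exists s1; rewrite // F3E addrC -F1E.
- by exists s2; rewrite // G3E addrC -G2E.
by exists (s *m A + t *m B); rewrite -F3E -G3E; split=> //; exists s, t.
Qed.

Definition prod_set m n (S : set 'rV[K]_m) (T : set 'rV[K]_n) : set 'rV[K]_(m + n) :=
  [set v | S (lsubmx v) /\ T (rsubmx v)].

Lemma prime_set_prod m n (S : set 'rV[K]_m) (T : set 'rV[K]_n) :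
  prime_set S -> prime_set T -> prime_set (prod_set S T).
Proof.
move=> hS hT; have := prime_set_sum (row_mx 1%:M 0) (row_mx 0 1%:M) hS hT.
congr prime_set; apply/seteqP; split=> [_ [s [t [Ss Tt ->]]]|v [Sv Tv]].
  rewrite !mul_mx_row !mulmx0 !mulmx1 add_row_mx addr0 add0r.
  by split; rewrite (row_mxKl, row_mxKr).
exists (lsubmx v), (rsubmx v); split=> //.
by rewrite !mul_mx_row !mulmx0 !mulmx1 add_row_mx addr0 add0r hsubmxK.
Qed.

Lemma has_chain_prod_prime m n k (S : set 'rV[K]_m) (T : set 'rV[K]_n) :
  has_chain k S -> prime_set T -> has_chain k (prod_set S T).
Proof.
move=> + hT; elim: k S => [|k IH] S /=; first by case=> hS _; split=> //; apply: prime_set_prod.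
move=> [hS [S' [S'S /IH hS' [f fS' [v Sv fv]]]]]; split; first exact: prime_set_prod.
have [t Tt] := hT.1.
exists (prod_set S' T); split=> //; first by move=> u [/S'S Su Tu].
have [g gE] := affine_substitution (col_mx 1%:M (0 : 'M_(n, m))) 0 f.
have {}gE (u : 'rV_(m + n)) : g.@[u 0] = f.@[(lsubmx u) 0].
  by rewrite gE -[u in u *m _]hsubmxK mul_row_col mulmx1 mulmx0 !addr0.
exists g; first by move=> u [/fS' f0 _]; rewrite gE.
by exists (row_mx v t); rewrite ?gE ?row_mxKl //; split; rewrite (row_mxKl, row_mxKr).
Qed.

Lemma has_chain_prod m n k l (S : set 'rV[K]_m) (T : set 'rV[K]_n) :
  has_chain k S -> has_chain l T -> has_chain (k + l) (prod_set S T).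
Proof.
move=> hS; elim: l T => [|l IH] T.
  by rewrite addn0 => -[hT _]; apply: has_chain_prod_prime.
move=> [hT [T' [T'T /IH hT' [f fT' [v Tv fv]]]]]; rewrite addnS; split.
  by apply: prime_set_prod => //; apply: has_chain_prime hS.
have [s Ss] := (has_chain_prime hS).1.
exists (prod_set S T'); split=> //; first by move=> u [Su /T'T].
have [g gE] := affine_substitution (col_mx (0 : 'M_(m, n)) 1%:M) 0 f.
have {}gE (u : 'rV_(m + n)) : g.@[u 0] = f.@[(rsubmx u) 0].
  by rewrite gE -[u in u *m _]hsubmxK mul_row_col mulmx1 mulmx0 add0r addr0.
exists g; first by move=> u [_ /fT' f0]; rewrite gE.
by exists (row_mx s v); rewrite ?gE ?row_mxKr //; split; rewrite (row_mxKl, row_mxKr).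
Qed.

Lemma prime_set0 m : prime_set [set 0 : 'rV[K]_m].
Proof.
have := prime_set_line (0 : 'rV[K]_m); congr prime_set.
by apply/seteqP; split=> [_ [t _ <-]|_ ->] /=; [rewrite scaler0|exists 0; rewrite ?scaler0].
Qed.

Lemma has_chain_line m (w : 'rV[K]_m) : w != 0 ->
  has_chain 1 (range (fun t => t *: w)).
Proof.
move=> w0; split; first exact: prime_set_line.
exists [set 0]; split; [by move=> _ ->; exists 0; rewrite ?scale0r| |].
  by split=> //; apply: prime_set0.
have [i wi] : exists i, w 0 i != 0.
  apply: contrapT => /forallNP wz; case/eqP: w0; apply/rowP => i; rewrite mxE.
  by apply/eqP/negPn/negP/wz.
exists 'X_i; first by move=> _ ->; rewrite mevalXU mxE.
by exists w; [exists 1; rewrite ?scale1r|rewrite mevalXU].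
Qed.

Lemma has_chain_full e : has_chain e [set: 'rV[K]_e].
Proof.
elim: e => [|e IH].
  split=> //; split; first by exists 0.
  by move=> F G [v _ Fv] [u _ Gu]; exists v; split=> //; rewrite (_ : v = u) // !thinmx0.
have h1 : has_chain 1 [set: 'rV[K]_1].
  have := @has_chain_line 1 (const_mx 1); set l := image _ _.
  have -> : l = setT.
    apply/seteqP; split=> // v _; exists (v 0 0) => //.
    by apply/rowP => i; rewrite !mxE mulr1 ord1.
  apply; apply/eqP => /rowP/(_ 0); rewrite !mxE => /eqP; apply/negP.
  exact: oner_neq0.
rewrite -[e.+1]/(1 + e)%N.
have -> : [set: 'rV[K]_(1 + e)] = prod_set [set: 'rV[K]_1] [set: 'rV[K]_e].
  by apply/seteqP; split.
exact: has_chain_prod.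
Qed.

End PrimeSetOperations.

(** * Integrality over the constants of a derivation *)

Section Constants.
Variable L : fieldType.

Definition constants (D : L -> L) (_ : derivation D) : {pred L} := fun u => D u == 0.

Lemma constants_subring D (D_der : derivation D) : subring_closed (constants D_der).
Proof.
split=> [|u v|u v]; rewrite !unfold_in.
- by rewrite derivation1.
- by move=> /eqP Du /eqP Dv; rewrite derivationB // Du Dv subrr.
- by move=> /eqP Du /eqP Dv; rewrite derivationM // Du Dv mulr0 mul0r addr0.
Qed.

HB.instance Definition _ D (D_der : derivation D) :=
  GRing.isSubringClosed.Build L (constants D_der) (constants_subring D_der).

Variables (D : L -> L) (D_der : derivation D).
Local Notation C := (constants D_der).

Lemma derivation_horner (p : {poly L}) u :
  p \is a polyOver C -> D p.[u] = p^`().[u] * D u.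
Proof.
elim/poly_ind: p => [|p c IH] hp; first by rewrite deriv0 !horner0 mul0r derivation0.
have /polyOverP hpc := hp.
have Dc : D c = 0 by have := hpc 0%N; rewrite coefD coefMX coefC add0r => /eqP.
have {}IH := IH _; rewrite derivD derivM derivX derivC addr0 mulr1.
rewrite !(hornerD, hornerM, hornerX, hornerC) derivationD // derivationM // Dc addr0.
rewrite IH; first by ring.
by apply/polyOverP => i; have := hpc i.+1; rewrite coefD coefMX coefC addr0.
Qed.

Hypothesis char0 : forall n, n.+1%:R != 0 :> L.

(** Passing to derivatives reaches a polynomial with constant coefficients having [u] as a simple
    root; there 0 = D(p(u)) = p'(u) D(u). *)
Lemma derivation_algebraic (p : {poly L}) u :
  p \is a polyOver C -> p != 0 -> root p u -> D u = 0.
Proof.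
move: {2}(size p) (leqnn (size p)) => n; elim: n p => [|n IH] p.
  by rewrite leqn0 size_poly_eq0 => ->.
move=> le_p hp pnz pu; have sp := root_size_gt1 pnz pu.
have p'nz : p^`() != 0.
  apply/eqP => /(congr1 (fun f : {poly L} => f`_(size p).-2)).
  rewrite coef_deriv coef0; case: (size p) (sp) (lead_coefE p) => [|[|s]] //= _ lE.
  rewrite -lE -mulr_natr => /eqP; rewrite mulf_eq0 (negbTE (char0 s)).
  by rewrite lead_coef_eq0 (negbTE pnz).
have hp' : p^`() \is a polyOver C by apply: polyOver_deriv.
have [p'u|p'u] := boolP (root p^`() u).
  by apply: IH p'u => //; rewrite -ltnS (leq_trans (lt_size_deriv pnz)).
have := derivation_horner u hp; rewrite (rootP pu) derivation0 // => /esym/eqP.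
by rewrite mulf_eq0 -[_ == 0]/(root _ _) (negbTE p'u) => /eqP.
Qed.

Variables (n : nat) (y : 'I_n -> L).

Definition bounded_degree (d : nat) : set L :=
  [set z | exists p : {mpoly L[n]},
    [/\ p \is a mpolyOver n C, (msize p <= d.+1)%N & z = p.@[y]]].

Lemma bounded_degreeS d e : (d <= e)%N -> bounded_degree d `<=` bounded_degree e.
Proof. by move=> de _ [p [hp sp ->]]; exists p; split=> //; apply: leq_trans sp _. Qed.

Lemma bounded_degreeB d u v :
  bounded_degree d u -> bounded_degree d v -> bounded_degree d (u - v).
Proof.
move=> [p [hp sp ->]] [q [hq sq ->]]; exists (p - q); rewrite mevalB.
split=> //; first exact: rpredB.
by rewrite (leq_trans (msizeD_le _ _)) // geq_max sp msizeN.
Qed.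

Lemma bounded_degreeD d u v :
  bounded_degree d u -> bounded_degree d v -> bounded_degree d (u + v).
Proof.
move=> [p [hp sp ->]] [q [hq sq ->]]; exists (p + q); rewrite mevalD.
split=> //; first exact: rpredD.
by rewrite (leq_trans (msizeD_le _ _)) // geq_max sp.
Qed.

Lemma bounded_degreeM d e u v :
  bounded_degree d u -> bounded_degree e v -> bounded_degree (d + e) (u * v).
Proof.
move=> [p [hp sp ->]] [q [hq sq ->]]; exists (p * q); rewrite mevalM.
split=> //; first exact: rpredM.
have [->|pnz] := eqVneq p 0; first by rewrite mul0r msize0.
have [->|qnz] := eqVneq q 0; first by rewrite mulr0 msize0.
by rewrite msizeM //; move: (msize p) (msize q) sp sq => a b; lia.
Qed.

Lemma bounded_degree_const d c : c \in C -> bounded_degree d c.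
Proof.
move=> hc; exists c%:MP; rewrite mevalC mpolyOverC; split=> //.
by rewrite msizeC; case: (c != 0).
Qed.

Lemma bounded_degree_monomial m : bounded_degree (mdeg m) ('X_[m].@[y]).
Proof. by exists 'X_[m]; rewrite msizeX mpolyOverX. Qed.

Lemma bounded_degree_var i : bounded_degree 1 (y i).
Proof. by have := bounded_degree_monomial U_(i); rewrite mevalXU mdeg1. Qed.

Lemma bounded_degreeX i k : bounded_degree k (y i ^+ k).
Proof.
elim: k => [|k IH]; first by rewrite expr0; apply: bounded_degree_const; apply: rpred1.
by rewrite exprS -add1n; apply: bounded_degreeM => //; apply: bounded_degree_var.
Qed.

Lemma bounded_degree_sum d (I : Type) (r : seq I) (P : pred I) (F : I -> L) :
  (forall i, P i -> bounded_degree d (F i)) -> bounded_degree d (\sum_(i <- r | P i) F i).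
Proof.
move=> hF; apply: big_ind => //; first by apply: bounded_degree_const; apply: rpred0.
by move=> u v; apply: bounded_degreeD.
Qed.

(* If each y i satisfies an equation whose remaining terms have lower total
   degree, then C[y] is spanned by finitely many monomials, so the y i are
   algebraic over C. *)
Lemma derivation_integral :
  (forall i, exists d, bounded_degree d (y i ^+ d.+1)) -> forall i, D (y i) = 0.
Proof.
move=> /choice[d dP]; pose e := (\sum_i d i)%N.
(* A monomial of degree above the sum [e] of the [d i] has some exponent exceeding [d i], and the
   equation of that [y i] lowers its degree. *)
have stab k : bounded_degree k `<=` bounded_degree e.
  elim: k => [|k IH]; first exact: bounded_degreeS.
  have [/bounded_degreeS //|lt_ek] := leqP k.+1 e.
  move=> _ [p [hp sp ->]]; rewrite (mpolywE sp) raddf_sum /=.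
  apply: bounded_degree_sum => m _; rewrite mevalZ -[e]add0n.
  apply: bounded_degreeM.
    by apply: bounded_degree_const; apply/mpolyOverP.
  have := bmdeg m; rewrite ltnS leq_eqVlt => /predU1P[dm|lt_mk]; last first.
    by apply: IH; apply: bounded_degreeS (bounded_degree_monomial m); rewrite -ltnS.
  have [i di] : exists i, (d i < (val m) i)%N.
    apply: contrapT => /forallNP h; move: lt_ek; rewrite -dm mdegE ltnNge /e.
    by rewrite leq_sum // => i _; rewrite leqNgt; apply/negP/h.
  apply: IH; rewrite -(submK (m := U_(i) *+ (d i).+1) (m' := val m)); last first.
    apply/mnm_lepP => j; rewrite mulmnE mnm1E; case: eqP => [<-|_] //.
    by rewrite mul1n.
  set m' := (_ - _)%MM.
  have dm' : (mdeg m' + (d i).+1 = k.+1)%N.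
    have := congr1 mdeg (submK (m := U_(i) *+ (d i).+1) (m' := val m) _).
    rewrite -/m' mdegD mdegMn mdeg1 mul1n dm; apply.
    apply/mnm_lepP => j; rewrite mulmnE mnm1E; case: eqP => [<-|_] //.
    by rewrite mul1n.
  rewrite mpolyXD mevalM -mpolyXn rmorphXn /= mevalXU.
  have -> : k = (mdeg m' + d i)%N by apply/eqP; rewrite -eqSS -addnS dm'.
  by apply: bounded_degreeM => //; apply: bounded_degree_monomial.
(* Determinant trick: multiplication by [y i] on the span of the monomials of degree at most [e] has
   a matrix of constants, of which [y i] is an eigenvalue. The eigenvector is nonzero because the
   monomial 1 occurs in it; the matrix is transposed because eigenvectors are rows. *)
move=> i; pose I : finType := 'X_{1..n < e.+1}.
pose w (a : I) := 'X_[val a].@[y].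
have [A hA Aw] : exists2 A : I -> I -> L, forall a b, A a b \in C &
    forall a, y i * w a = \sum_b A a b * w b.
  have hw a : exists A : I -> L, (forall b, A b \in C) /\ y i * w a = \sum_b A b * w b.
    have := bounded_degreeM (bounded_degree_var i) (bounded_degree_monomial (val a)).
    move=> /stab[p [/mpolyOverP hp sp ->]]; exists (fun b => p@_(val b)); split=> //.
    rewrite {1}(mpolywE sp) raddf_sum /=.
    by apply: eq_bigr => b _; rewrite mevalZ.
  have [A AP] := choice hw; exists A; first by move=> a; case: (AP a).
  by move=> a; case: (AP a).
pose M := \matrix_(s < #|I|, t < #|I|) A (enum_val t) (enum_val s).
apply: (@derivation_algebraic (char_poly M)).
- have hM s t : M s t \in C by rewrite mxE.
  apply: rpred_sum => s _; apply: rpredM; first by rewrite rpredX // rpredN rpred1.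
  apply: rpred_prod => t _; rewrite !mxE.
  by apply: rpredB; [rewrite rpredMn // polyOverX|rewrite polyOverC].
- by rewrite monic_neq0 // char_poly_monic.
rewrite -eigenvalue_root_char; apply/eigenvalueP.
exists (\row_s w (enum_val s)).
  apply/rowP => s; rewrite !mxE Aw [RHS](reindex_onto enum_val enum_rank) /=; last first.
    by move=> a _; rewrite enum_rankK.
  apply: eq_big => [t|t _]; first by rewrite enum_valK eqxx.
  by rewrite !mxE mulrC.
have lt0 : (mdeg (0%MM : 'X_{1..n}) < e.+1)%N by rewrite mdeg0.
apply/eqP => /rowP/(_ (enum_rank (BMultinom lt0 : I))).
rewrite !mxE enum_rankK /w /= mpolyX0 meval1 => /eqP; apply/negP; exact: oner_neq0.
Qed.

End Constants.

(** * Cramer's rule, homogeneity and Jacobian minors *)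

(** Cramer's rule with cleared denominators: the coefficients of [h] on the rows of [A] are read off
    the columns [beta], and the right-hand side stays polynomial in the entries of [h] and [A]. *)
Lemma cramer_submx (R : fieldType) c m (A : 'M[R]_(c, m)) (beta : 'I_c -> 'I_m)
    (h : 'rV_m) : (h <= A)%MS ->
  \det (colsub beta A) *: h = colsub beta h *m \adj (colsub beta A) *m A.
Proof.
move=> /submxP[D ->].
have -> : colsub beta (D *m A) = D *m colsub beta A.
  by apply/matrixP => i j; rewrite !mxE; apply: eq_bigr => k _; rewrite !mxE.
by rewrite -!mulmxA [_ *m (_ *m A)]mulmxA mul_mx_adj mul_scalar_mx -scalemxAr.
Qed.

Section Homogeneous.
Variables (K L : fieldType) (iota : {rmorphism K -> L}) (m : nat).

Lemma mmap_homog d (f : {mpoly K[m]}) (t : L) (v : 'rV[L]_m) :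
  f \is d.-homog -> mmap iota ((t *: v) 0) f = t ^+ d * mmap iota (v 0) f.
Proof.
move=> /dhomogP hf; rewrite /mmap mulr_sumr; apply: eq_big_seq => k kf.
have <- : mdeg k = d := hf k kf.
rewrite mulrCA; congr (_ * _); rewrite /mmap1 mdegE -prodrXr -big_split.
by apply: eq_bigr => i _; rewrite mxE exprMn.
Qed.

Lemma mderiv_homog d j (f : {mpoly K[m]}) :
  f \is d.-homog -> f^`M(j) \is d.-1.-homog.
Proof.
move=> /dhomogP hf; apply/dhomogP => k.
rewrite mcoeff_msupp mcoeff_mderiv => nz; have kf : (k + U_(j))%MM \in msupp f.
  by rewrite mcoeff_msupp; apply: contraNneq nz => ->; rewrite mul0rn.
have <- : mdeg (k + U_(j))%MM = d := hf _ kf.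
by rewrite mdegD mdeg1 addn1.
Qed.

End Homogeneous.

Definition gradients (K : fieldType) m c (f : 'I_c -> {mpoly K[m]}) :
    'M[{mpoly K[m]}]_(c, m) := \matrix_(i, j) (f i)^`M(j).

Definition jacobian_minor (K : fieldType) m c (f : 'I_c -> {mpoly K[m]})
  (beta : 'I_c -> 'I_m) : {mpoly K[m]} := \det (colsub beta (gradients f)).

Lemma mmap_jacobian_minor (K L : fieldType) (iota : {rmorphism K -> L}) m c
    (f : 'I_c -> {mpoly K[m]}) beta v :
  mmap iota v (jacobian_minor f beta) =
  \det (colsub beta (map_mx (mmap iota v) (gradients f))).
Proof. by rewrite -map_mxsub det_map_mx. Qed.

Lemma gradients_scale (K L : fieldType) (iota : {rmorphism K -> L}) m c
    (f : 'I_c -> {mpoly K[m]}) (t : L) (v : 'rV[L]_m) : t != 0 ->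
  (forall i, exists d, f i \is d.-homog) ->
  exists2 s : 'rV[L]_c, forall i, s 0 i != 0 &
    map_mx (mmap iota ((t *: v) 0)) (gradients f) =
    diag_mx s *m map_mx (mmap iota (v 0)) (gradients f).
Proof.
move=> tnz /choice[d dP]; exists (\row_i t ^+ (d i).-1).
  by move=> i; rewrite mxE expf_neq0.
apply/matrixP => i j; rewrite mul_diag_mx !mxE.
by rewrite (mmap_homog iota (d := (d i).-1)) //; apply: mderiv_homog.
Qed.

Lemma subalgebra_det (K : closedFieldType) (L : fieldType) (iota : {rmorphism K -> L})
    (O : set L) n (A : 'M[L]_n) :
  subalgebra iota O -> (forall i j, O (A i j)) -> O (\det A).
Proof.
move=> hO OA; have [OC OB OM] := hO; apply: (subalgebra_sum _ hO) => s; apply: (OM).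
  by rewrite -(rmorphN1 iota) -rmorphXn.
apply: big_ind => //; exact: subalgebra1 hO.
Qed.

Lemma subalgebra_cofactor (K : closedFieldType) (L : fieldType)
    (iota : {rmorphism K -> L}) (O : set L) n (A : 'M[L]_n) i j :
  subalgebra iota O -> (forall i j, O (A i j)) -> O (cofactor A i j).
Proof.
move=> hO OA; have [OC OB OM] := hO; apply: (OM).
  by rewrite -(rmorphN1 iota) -rmorphXn.
by apply: (subalgebra_det hO) => a b; rewrite !mxE.
Qed.

(** * Integrality of the projection, tested at infinity *)

Section Integrality.
Variables (K : closedFieldType) (L : fieldType) (iota : {rmorphism K -> L}).
Hypothesis char0 : forall n, n.+1%:R != 0 :> L.

(** The point is that the remainder stays in [O], so that the expansion can be read modulo powers of
    [t]; it passes to sums and products from the variables. *)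
Lemma taylor2 (O : set L) m (u w : 'rV[L]_m) (t : L) (f : {mpoly K[m]}) :
  subalgebra iota O -> O t -> (forall i, O (u 0 i)) -> (forall i, O (w 0 i)) ->
  exists2 r, O r & mmap iota ((u + t *: w) 0) f = mmap iota (u 0) f +
    t * (\sum_i mmap iota (u 0) f^`M(i) * w 0 i) + t ^+ 2 * r.
Proof.
move=> hO Ot Ou Ow; have O0 := subalgebra0 hO.
have OD a b : O a -> O b -> O (a + b) by apply: (subalgebraD hO).
have OM a b : O a -> O b -> O (a * b) by case: hO => _ _; apply.
have Of p : O (mmap iota (u 0) p).
  elim/mpoly_ring_ind: p => [c|i|p q hp hq|p q hp hq].
  - by rewrite mmapC; case: hO => + _ _; apply.
  - by rewrite mmapXU.
  - by rewrite rmorphD; apply: OD.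
  - by rewrite rmorphM; apply: OM.
pose d p := \sum_i mmap iota (u 0) p^`M(i) * w 0 i.
have Od p : O (d p) by apply: (subalgebra_sum _ hO) => i; apply: OM.
rewrite -/(d f); elim/mpoly_ring_ind: f => [c|i|p q|p q].
- exists 0 => //; rewrite !mmapC /d big1 ?mulr0 ?addr0 // => i _.
  by rewrite mderivC mmap0 mul0r.
- exists 0 => //; rewrite !mmapXU /d (bigD1 i) //= big1 ?addr0; last first.
    by move=> j ji; rewrite mderivXU eq_sym (negbTE ji) mmapC raddf0 mul0r.
  by rewrite mderivXU eqxx mmapC /= rmorph1 mul1r mulr0 addr0 !mxE.
- move=> [r Or er] [s Os es]; exists (r + s); first exact: OD.
  have -> : d (p + q) = d p + d q.
    rewrite /d; apply: etrans (big_split _ _ _ _ _).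
    by apply: eq_bigr => i _; rewrite mderivD rmorphD mulrDl.
  rewrite !rmorphD /= er es; ring.
- move=> [r Or er] [s Os es].
  have -> : d (p * q) = mmap iota (u 0) p * d q + d p * mmap iota (u 0) q.
    rewrite /d [X in X + _]mulr_sumr [X in _ + X]mulr_suml.
    transitivity (\sum_i (mmap iota (u 0) p * (mmap iota (u 0) q^`M(i) * w 0 i) +
      mmap iota (u 0) p^`M(i) * w 0 i * mmap iota (u 0) q)); last exact: big_split.
    apply: eq_bigr => i _; rewrite mderivM rmorphD !rmorphM /=; ring.
  set a := mmap iota (u 0) p in er *; set b := mmap iota (u 0) q in es *.
  exists (d p * d q + (a * s + r * b) + (t * (d p * s + r * d q) + t ^+ 2 * (r * s))).
    have Ot2 : O (t ^+ 2) by rewrite expr2; apply: OM.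
    have [Oa Ob] : O a /\ O b by split; apply: Of.
    apply: (OD); first by apply: (OD); [apply: (OM)|apply: (OD); apply: (OM)].
    by apply: (OD); apply: (OM) => //; [apply: (OD); apply: (OM)|apply: (OM)].
  rewrite !rmorphM /= er es -/a -/b; ring.
Qed.

Variables (D : L -> L) (D_der : derivation D).
Hypothesis D_iota : forall c, D (iota c) = 0.
Variables (m c : nat) (I : set {mpoly K[m]}) (y p h : 'rV[L]_m).
Hypothesis I_homog : forall f, I f -> exists d, f \is d.-homog.
Hypothesis I_y : forall f, I f -> mmap iota (y 0) f = 0.
Hypothesis I_yp : forall f, I f -> mmap iota ((y - p) 0) f = 0.
Hypothesis Dp : forall i, D (p 0 i) = 0.
Hypothesis Dh : forall i, D (h 0 i) = 0.
Hypothesis hp_neq0 : \sum_i h 0 i * p 0 i != 0.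
Hypothesis I_smooth : forall v : 'rV[K]_m, (forall f, I f -> f.@[v 0] = 0) ->
  (forall (f : 'I_c -> {mpoly K[m]}) beta, (forall i, I (f i)) ->
     (jacobian_minor f beta).@[v 0] = 0) -> v = 0.
Hypothesis h_normal : forall (f : 'I_c -> {mpoly K[m]}) beta, (forall i, I (f i)) ->
  mmap iota (y 0) (jacobian_minor f beta) != 0 ->
  (h <= map_mx (mmap iota (y 0)) (gradients f))%MS.

(** Put t = 1 / y_i and u = t y. Modulo t, the point u lies on X with p in its tangent space, and h
    is conormal there, so t divides h(p) in the ring [O] below. As h(p) is a nonzero constant, y_i
    itself lies in [O], which says that some power y_i^(d + 1) is a polynomial in y of degree at
    most d. *)
Lemma integral_over_constants i : D (y 0 i) = 0.
Proof.
apply: (derivation_integral (D_der := D_der) char0 (y := y 0)) i => i.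
set F := bounded_degree D_der (y 0).
have F1 c0 k : D c0 = 0 -> F k c0.
  by move=> Dc; apply: bounded_degree_const; rewrite unfold_in Dc.
have [yi0|yinz] := eqVneq (y 0 i) 0.
  by exists 0%N; rewrite yi0 expr1; apply: F1; apply: derivation0.
set t := (y 0 i)^-1; pose u := t *: y.
have tnz : t != 0 by rewrite invr_eq0.
(* Fractions P(y) / y_i^d with deg P at most d: the ring generated over the constants by [t] and the
   entries of [u], that is, the functions on the chart at infinity where y_i is inverted. *)
pose O : set L := [set z | exists d, F d (z * y 0 i ^+ d)].
have Oconst a : D a = 0 -> O a by move=> Da; exists 0%N; rewrite mulr1; apply: F1.
have OM a b : O a -> O b -> O (a * b).
  move=> [d Fa] [e Fb]; exists (d + e)%N.
  by rewrite exprD mulrACA; apply: bounded_degreeM.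
have hO : subalgebra iota O.
  split=> // [a|a b [d Fa] [e Fb]]; first by apply: Oconst.
  exists (d + e)%N; rewrite mulrBl; apply: bounded_degreeB.
    rewrite exprD mulrA; apply: bounded_degreeM => //; exact: bounded_degreeX.
  by rewrite addnC exprD mulrA; apply: bounded_degreeM => //; apply: bounded_degreeX.
have Ot : O t by exists 1%N; rewrite expr1 mulVf //; apply: F1; apply: derivation1.
have Ou j : O (u 0 j).
  exists 1%N; rewrite expr1 mxE mulrAC mulVf // mul1r; exact: bounded_degree_var.
have Ov f : O (mmap iota (u 0) f).
  elim/mpoly_ring_ind: f => [a|j|f g hf hg|f g hf hg].
  - by rewrite mmapC; apply: Oconst; apply: D_iota.
  - by rewrite mmapXU.
  - by rewrite rmorphD; apply: (subalgebraD hO).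
  - by rewrite rmorphM; apply: OM.
have I_u f : I f -> mmap iota (u 0) f = 0.
  by move=> If; have [d hf] := I_homog If; rewrite (mmap_homog _ _ _ hf) I_y ?mulr0.
pose df f := \sum_j mmap iota (u 0) f^`M(j) * p 0 j.
(* At the point u, which reduces to a point of X modulo t, the hyperplane h is
   a combination of differentials that vanish at p modulo t. *)
have df_t f : I f -> exists2 r, O r & df f = t * r.
  move=> If; have [|r Or] := @taylor2 O m u (- p) t f hO Ot Ou.
    by move=> j; rewrite mxE; apply: Oconst; rewrite derivationN // Dp oppr0.
  (* Since u - t p = t (y - p) is again a zero of [f], the expansion reads 0 = - t (df f) + t^2
     r. *)
  rewrite I_u // add0r scalerN -scalerBr; have [d hf] := I_homog If.
  rewrite (mmap_homog _ _ _ hf) I_yp // mulr0.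
  have -> : \sum_j mmap iota (u 0) f^`M(j) * (- p) 0 j = - df f.
    by rewrite /df -sumrN; apply: eq_bigr => j _; rewrite mxE mulrN.
  move=> e; exists r => //; apply: (mulfI tnz); apply/eqP.
  rewrite -subr_eq0 -oppr_eq0 eq_sym; apply/eqP; rewrite [LHS]e; ring.
pose hp := \sum_j h 0 j * p 0 j.
have Dhp : D hp = 0.
  rewrite /hp derivation_sum // big1 // => j _.
  by rewrite derivationM // Dp Dh mulr0 mul0r addr0.
(* By Cramer, the minor times [h] is a combination of the gradients at [u] with coefficients in [O];
   pairing with [p] gives multiples of [t] by [df_t]. *)
have minor_t (f : 'I_c -> {mpoly K[m]}) beta : (forall k, I (f k)) ->
    exists2 r, O r & mmap iota (u 0) (jacobian_minor f beta) * hp = t * r.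
  move=> If; have [->|nz] := eqVneq (mmap iota (u 0) (jacobian_minor f beta)) 0.
    by exists 0; rewrite ?mul0r ?mulr0 //; apply: (subalgebra0 hO).
  have [s snz Ju] := gradients_scale iota y tnz (fun k => I_homog (If k)).
  set J := map_mx (mmap iota (u 0)) (gradients f).
  have hJ : (h <= J)%MS.
    have : (h <= map_mx (mmap iota (y 0)) (gradients f))%MS.
      apply: (h_normal (beta := beta) If); apply: contraNneq nz => nz.
      rewrite mmap_jacobian_minor Ju.
      have -> : colsub beta (diag_mx s *m map_mx (mmap iota (y 0)) (gradients f)) =
          diag_mx s *m colsub beta (map_mx (mmap iota (y 0)) (gradients f)).
        by apply/matrixP => k l; rewrite !mul_diag_mx !mxE.
      by rewrite det_mulmx -mmap_jacobian_minor nz mulr0.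
    move/submx_trans; apply.
    rewrite /J Ju; apply/submxP; exists (diag_mx (\row_k (s 0 k)^-1)).
    rewrite mulmxA mulmx_diag (_ : (\row_i0 _) = const_mx 1) ?diag_const_mx ?mul1mx //.
    by apply/rowP => k; rewrite !mxE mulVf.
  have Ohj j : O (h 0 j) by apply: Oconst.
  pose r := colsub beta h *m \adj (colsub beta J).
  have Or k : O (r 0 k).
    rewrite mxE; apply: (subalgebra_sum _ hO) => j; apply: OM; first by rewrite mxE.
    by rewrite mxE; apply: (subalgebra_cofactor _ _ hO) => a b; rewrite !mxE; apply: Ov.
  have [w Ow dw] : exists2 w : 'I_c -> L, forall k, O (w k) & forall k, df (f k) = t * w k.
    have hw k : exists w, O w /\ df (f k) = t * w.
      by have [w ? ?] := df_t _ (If k); exists w.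
    by have [w wP] := choice hw; exists w => k; case: (wP k).
  exists (\sum_k r 0 k * w k); first by apply: (subalgebra_sum _ hO) => k; apply: OM.
  rewrite mmap_jacobian_minor -/J; have := cramer_submx beta hJ; rewrite -/r => e.
  transitivity (\sum_k r 0 k * df (f k)); last first.
    by rewrite mulr_sumr; apply: eq_bigr => k _; rewrite dw mulrCA.
  rewrite /hp mulr_sumr.
  transitivity (\sum_j (r *m J) 0 j * p 0 j).
    by apply: eq_bigr => j _; rewrite mulrA -e mxE.
  under eq_bigr => j _ do rewrite mxE mulr_suml.
  rewrite exchange_big; apply: eq_bigr => k _; rewrite /df mulr_sumr.
  by apply: eq_bigr => j _; rewrite !mxE mulrA.
(* By smoothness the equations and the minors have at most the origin as common zero. The i-th entry
   of [u] is 1, so evaluating a power of the i-th variable at [u] removes the minor from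
   [minor_t]. *)
have [M [s [sP es]]] : exists M, ideal_generated (I `|` [set g |
    exists (f : 'I_c -> {mpoly K[m]}) beta, (forall k, I (f k)) /\
      g = jacobian_minor f beta]) ('X_i ^+ M).
  apply: nullstellensatz => v hv; rewrite mevalXU.
  have vE f : f.@[v] = f.@[(\row_j v j) 0] by apply: meval_eq => j; rewrite mxE.
  suff /rowP/(_ i) : \row_j v j = 0 by rewrite !mxE.
  apply: I_smooth => [f If|f beta If]; rewrite -vE; apply: hv; first by left.
  by right; exists f, beta.
have [r Or er] : exists2 r, O r & hp = t * r.
  have -> : hp = mmap iota (u 0) ('X_i ^+ M) * hp.
    by rewrite rmorphXn /= mmapXU mxE mulVf // expr1n mul1r.
  rewrite es rmorph_sum mulr_suml /= big_seq.
  apply: (big_ind (fun z => exists2 r, O r & z = t * r)).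
  - by exists 0; rewrite ?mulr0 //; apply: (subalgebra0 hO).
  - move=> _ _ [a Oa ->] [b Ob ->]; exists (a + b); last by rewrite mulrDr.
    exact: subalgebraD hO _ _.
  - move=> ab /sP[Ib|[f [beta [If eb]]]].
      by exists 0; [apply: (subalgebra0 hO)|rewrite rmorphM /= (I_u _ Ib) mulr0 mul0r mulr0].
    have [r Or er] := minor_t f beta If; exists (mmap iota (u 0) ab.1 * r).
      exact: OM.
    by rewrite rmorphM /= eb -mulrA er mulrCA.
have [d Fd] : O (y 0 i).
  have -> : y 0 i = r * hp^-1.
    by apply: (mulIf hp_neq0); rewrite -/hp divfK // er mulrA divff ?mul1r.
  apply: OM => //; apply: Oconst; exact: derivationV.
by exists d; rewrite exprS.
Qed.
End Integrality.

(** * Linear algebra of conormal spaces *)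

Section LinearAlgebra.
Variable F : fieldType.

Lemma vspace_mx m (T : {vspace 'rV[F]_m}) : exists B : 'M[F]_(\dim T, m),
  row_free B /\ forall u, (u \in T) = (u <= B)%MS.
Proof.
pose B := \matrix_(i < \dim T) (vbasis T)`_i.
have BE (k : 'rV_(\dim T)) : k *m B = \sum_i k 0 i *: (vbasis T)`_i.
  by rewrite mulmx_sum_row; apply: eq_bigr => i _; rewrite rowK.
exists B; split.
  apply: inj_row_free => k; rewrite BE => k0; apply/rowP => i; rewrite mxE.
  by have /freeP := basis_free (vbasisP T); apply.
move=> u; apply/idP/submxP => [uT|[k ->]].
  exists (\row_i coord (vbasis T) i u); rewrite BE [LHS](coord_vbasis uT).
  by apply: eq_bigr => i _; rewrite mxE.
rewrite BE; apply: memv_suml => i _; apply: memvZ; apply: vbasis_mem.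
by apply: mem_nth; rewrite size_tuple.
Qed.

Variables (m c : nat) (G : set 'rV[F]_m) (T : {vspace 'rV[F]_m}).
Hypothesis dimT : (\dim T + c)%N = m.
Hypothesis G_normal : forall u, u \in T <-> forall g, G g -> u *m g^T = 0.

(** The basis of the annihilator of [T] is chosen inside [G], hence consists of gradients of actual
    equations: a free family in [G] of maximal size spans [G], so it cuts out [T] and has [c]
    members. *)
Lemma normal_space_basis :
  exists A : 'M[F]_(c, m), (forall i, G (row i A)) /\ row_free A.
Proof.
pose P k := `[< exists A : 'M[F]_(k, m), (forall i, G (row i A)) /\ row_free A >].
have exP : exists k, P k.
  exists 0%N; apply/asboolP; exists 0; split; first by case.
  by rewrite -row_leq_rank.
have leP k : P k -> (k <= m)%N.
  by move=> /asboolP[A [_ /eqP<-]]; apply: rank_leq_col.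
case: (ex_maxnP exP leP) => k /asboolP[A [GA freeA]] max_k.
have GA' g : G g -> (g <= A)%MS.
  move=> Gg; apply: contrapT => /negP gA.
  have := max_k (1 + k)%N; rewrite ltnn => no; suff : false by []; apply: no.
  apply/asboolP; exists (col_mx g A); split.
    move=> i; case: (split_ordP i) => j ->.
      by rewrite rowKu ord1 row_id.
    by rewrite rowKd.
  have [B [freeB BT]] := vspace_mx T.
  rewrite -row_leq_rank -addsmxE.
  have := mxrank_sum_cap g A.
  have -> : \rank (g :&: A)%MS = 0%N.
    apply/eqP; rewrite mxrank_eq0; apply/rowV0P => w; rewrite sub_capmx.
    move=> /andP[/sub_rVP[t ->] tgA]; have [->|tnz] := eqVneq t 0; first by rewrite scale0r.
    by case/negP: gA; move: tgA; rewrite eqmx_scale.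
  rewrite addn0 => ->; rewrite (eqP freeA) leq_add2r lt0n mxrank_eq0.
  by apply: contraNneq gA => ->; apply: sub0mx.
have [B [freeB BT]] := vspace_mx T.
have : (B == kermx A^T)%MS.
  apply/andP; split.
    apply/rV_subP => u; rewrite -BT => /G_normal uG; apply/sub_kermxP.
    apply/rowP => j; have := uG _ (GA j) => /rowP/(_ 0); rewrite !mxE => e.
    by rewrite -[RHS]e; apply: eq_bigr => l _; rewrite !mxE.
  apply/rV_subP => u /sub_kermxP uA; rewrite -BT; apply/G_normal => g /GA'/submxP[D ->].
  by rewrite trmx_mul mulmxA uA mul0mx.
move=> /eqmx_rank; rewrite (eqP freeB) mxrank_ker mxrank_tr (eqP freeA) => e.
have kc : k = c by have := leP _ (asboolT (ex_intro _ A (conj GA freeA))); move: e dimT; lia.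
by move: A GA freeA {GA'} e max_k; rewrite kc => A GA freeA _ _; exists A.
Qed.

Lemma normal_space_sub (A : 'M[F]_(c, m)) g :
  (forall i, G (row i A)) -> row_free A -> G g -> (g <= A)%MS.
Proof.
move=> GA freeA Gg; have [B [freeB BT]] := vspace_mx T.
have killB g' : G g' -> (g' <= kermx B^T)%MS.
  move=> Gg'; apply/sub_kermxP; apply: trmx_inj; rewrite trmx_mul trmxK trmx0.
  apply/row_matrixP => i; rewrite row_mul row0.
  by apply: (iffLR (G_normal _)) => //; rewrite BT; apply: row_sub.
have AB : (A <= kermx B^T)%MS by apply/row_subP => i; apply: killB.
have [_ /esym] := mxrank_leqif_sup AB.
rewrite mxrank_ker mxrank_tr (eqP freeA) (eqP freeB).
have -> : (c == m - \dim T)%N by apply/eqP; move: dimT; lia.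
by move=> sub; apply: submx_trans (killB g Gg) _; rewrite sub.
Qed.

End LinearAlgebra.

Lemma row_free_sub (F : fieldType) m n e (A : 'M[F]_(m, n)) : (e <= \rank A)%N ->
  exists2 W : 'M[F]_(e, n), row_free W & (W <= A)%MS.
Proof.
move=> le_e; exists (pid_mx e *m row_base A).
  by rewrite /row_free mxrankMfree ?row_base_free // rank_pid_mx.
by apply: submx_trans (submxMl _ _) _; rewrite eq_row_base.
Qed.

Lemma row_free_minor (F : fieldType) c m (A : 'M[F]_(c, m)) : row_free A ->
  exists beta : 'I_c -> 'I_m, \det (colsub beta A) != 0.
Proof.
move=> freeA; have fullA : row_full A^T by rewrite /row_full mxrank_tr.
exists (fullrankfun fullA).
have : row_full (rowsub (fullrankfun fullA) A^T).
  exact: fullrowsub_full.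
rewrite row_full_unit unitmxE unitfE -det_tr.
by congr (\det _ != 0); apply/matrixP => i j; rewrite !mxE.
Qed.

Lemma minor_row_free (F : fieldType) c m (A : 'M[F]_(c, m)) beta :
  \det (colsub beta A) != 0 -> row_free A.
Proof.
rewrite -unitfE -unitmxE => unitA.
have [R RE] : exists R : 'M_(m, c), colsub beta A = A *m R.
  exists (colsub beta 1%:M); apply/matrixP => i j; rewrite !mxE (bigD1 (beta j)) //= !mxE eqxx.
  by rewrite mulr1 big1 ?addr0 // => k kj; rewrite !mxE (negbTE kj) mulr0.
by apply/row_freeP; exists (R *m invmx (colsub beta A)); rewrite mulmxA -RE mulmxV.
Qed.

(** * The dimension count *)

Lemma matrix_common_denominator (K L : fieldType) (iota : {rmorphism K -> L}) m
    (xi : 'rV[L]_m) a b (A : 'M[L]_(a, b)) :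
  (forall z, exists F G, mmap iota (xi 0) G != 0 /\
     z = mmap iota (xi 0) F / mmap iota (xi 0) G) ->
  exists d (A' : 'M[{mpoly K[m]}]_(a, b)), mmap iota (xi 0) d != 0 /\
    map_mx (mmap iota (xi 0)) A' = mmap iota (xi 0) d *: A.
Proof.
move=> frac; have [F FP] := choice (fun ij : 'I_a * 'I_b => frac (A ij.1 ij.2)).
have [G GP] := choice FP.
exists (\prod_ij G ij), (\matrix_(i, j) (F (i, j) * \prod_(kl | kl != (i, j)) G kl)).
split.
  by rewrite rmorph_prod; apply/prodf_neq0 => ij _; case: (GP ij).
apply/matrixP => i j; rewrite !mxE rmorphM [in RHS](bigD1 (i, j)) //= rmorphM /=.
have [nz /= ->] := GP (i, j).
by rewrite mulrAC mulrCA divff // mulr1.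
Qed.

Section DimensionCount.
Variable K : closedFieldType.
Hypothesis char0 : forall n, n.+1%:R != 0 :> K.
Variables (m n c a : nat) (I : set {mpoly K[m]}) (X C : set 'rV[K]_m) (A : 'M[K]_(c, m)).
Hypothesis mE : m = (n + 1 + c)%N.
Hypothesis I_homog : forall f, I f -> exists d, f \is d.-homog.
Hypothesis I_X : forall f, I f -> forall v, X v -> f.@[v 0] = 0.
Hypothesis I_smooth : forall v : 'rV[K]_m, (forall f, I f -> f.@[v 0] = 0) -> v != 0 ->
  exists2 T : {vspace 'rV[K]_m}, \dim T = n.+1 & forall u, u \in T <->
    forall f, I f -> \sum_i f^`M(i).@[v 0] * u 0 i = 0.
Hypothesis X_chain : has_chain (n + 1) X.
Hypothesis X_nondegenerate : forall h : 'rV[K]_m, h != 0 ->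
  exists2 v, X v & \sum_i h 0 i * v 0 i != 0.
Hypothesis C_chain : has_chain (a + 2) C.
Hypothesis CX : C `<=` X.
Hypothesis A_free : row_free A.
Hypothesis CA : forall v, C v -> v *m A^T = 0.

Let fieldC0 (L : fieldType) (iota : {rmorphism K -> L}) k : k.+1%:R != 0 :> L.
Proof. by rewrite -(rmorph_nat iota) fmorph_eq0. Qed.

Let grad_at (v : 'rV[K]_m) : set 'rV[K]_m :=
  [set g | exists2 f, I f & g = \row_i f^`M(i).@[v 0]].

Let smooth_normal (v : 'rV[K]_m) : (forall f, I f -> f.@[v 0] = 0) -> v != 0 ->
  exists2 T : {vspace 'rV[K]_m}, (\dim T + c)%N = m & forall u, u \in T <->
    forall g, grad_at v g -> u *m g^T = 0.
Proof.
move=> Iv vnz; have [T dT TP] := I_smooth Iv vnz; exists T; first by rewrite dT mE; lia.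
move=> u; rewrite TP; split=> [uT _ [f If ->]|uT f If].
  apply/rowP => i; rewrite !mxE -[RHS](uT f If); apply: eq_bigr => j _.
  by rewrite !mxE mulrC.
have := uT _ (ex_intro2 _ _ f If erefl) => /rowP/(_ 0); rewrite !mxE => e.
by rewrite -[RHS]e; apply: eq_bigr => j _; rewrite !mxE mulrC.
Qed.

Let row_gradients (f : 'I_c -> {mpoly K[m]}) (v : 'rV[K]_m) i :
  row i (map_mx (meval (v 0)) (gradients f)) = \row_j (f i)^`M(j).@[v 0].
Proof. by apply/rowP => j; rewrite !mxE. Qed.

Let smooth_minor (v : 'rV[K]_m) : (forall f, I f -> f.@[v 0] = 0) -> v != 0 ->
  exists (f : 'I_c -> {mpoly K[m]}) beta, (forall i, I (f i)) /\
    (jacobian_minor f beta).@[v 0] != 0.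
Proof.
move=> Iv vnz; have [T dT TP] := smooth_normal Iv vnz.
have [B [GB freeB]] := normal_space_basis dT TP.
have hf i : exists f, I f /\ row i B = \row_j f^`M(j).@[v 0].
  by have [f If e] := GB i; exists f.
have [f fP] := choice hf.
have [beta nz] := row_free_minor freeB; exists f, beta; split; first by move=> i; case: (fP i).
rewrite [_.@[_]](mmap_jacobian_minor idfun).
suff -> : map_mx (mmap idfun (v 0)) (gradients f) = B by [].
by apply/row_matrixP => i; rewrite row_gradients; case: (fP i) => _ ->.
Qed.

Let smooth_sub (v : 'rV[K]_m) (f f' : 'I_c -> {mpoly K[m]}) beta :
  (forall f, I f -> f.@[v 0] = 0) -> v != 0 ->
  (forall i, I (f i)) -> (forall i, I (f' i)) -> (jacobian_minor f beta).@[v 0] != 0 ->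
  (map_mx (meval (v 0)) (gradients f') <= map_mx (meval (v 0)) (gradients f))%MS.
Proof.
move=> Iv vnz If If'; have [T dT TP] := smooth_normal Iv vnz.
rewrite [_.@[_]](mmap_jacobian_minor idfun) => /minor_row_free free.
apply/row_subP => i; apply: (normal_space_sub dT TP) => //.
  by move=> j; rewrite row_gradients; exists (f j).
by rewrite row_gradients; exists (f' i).
Qed.

Let C_prime : prime_set C. Proof. exact: has_chain_prime C_chain. Qed.

Let IC f (v : 'rV[K]_m) : I f -> C v -> f.@[v 0] = 0.
Proof. by move=> If /CX; apply: I_X. Qed.

(** Two spaces of linear forms of dimension [c], both annihilating [a + 2] independent tangent
    vectors, meet in dimension at least 2c - (m - (a + 2)). *)
Let e := (a + c + 1 - n)%N.

(* Over the generic point y of C, the rows of mu *m A form a free family of e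
   linear forms vanishing both on the tangent space of X at y and on the
   linear space cut out by A. *)
Let normal_family : exists (d : {mpoly K[m]}) (lambda mu : 'M[{mpoly K[m]}]_(e, c))
    (rho : 'M[{mpoly K[m]}]_(c, e)) (f : 'I_c -> {mpoly K[m]}),
  [/\ forall i, I (f i), nonvanishing d C,
    forall v, C v -> map_mx (meval (v 0)) mu *m A =
      map_mx (meval (v 0)) lambda *m map_mx (meval (v 0)) (gradients f),
    forall v, C v -> map_mx (meval (v 0)) mu *m map_mx (meval (v 0)) rho =
      (d.@[v 0])%:M &
    map_mx (meval ((0 : 'rV[K]_m) 0)) mu = 0].
Proof.
have [L [iota [xi [gen frac]]]] := generic_point_exists C_prime.
have [phi [D [D_der D_iota D_phi]]] := chain_derivations (fieldC0 iota) gen C_chain.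
pose ev : {rmorphism {mpoly K[m]} -> L} := mmap iota (xi 0).
(* The rows are tangent vectors to [C] at its generic point, independent because the derivations are
   dual to [phi]. *)
pose Dm := \matrix_(i < a + 2, j < m) D i (xi 0 j).
have D_ev i F : D i (ev F) = \sum_j ev F^`M(j) * Dm i j.
  rewrite /ev /= (derivation_mmap (D_der i)) //; apply: eq_bigr => j _.
  by rewrite mxE.
have freeD : row_free Dm.
  apply/row_freeP; exists (\matrix_(j, k) ev (phi k)^`M(j)).
  apply/matrixP => i k; rewrite !mxE -D_phi [RHS]D_ev; apply: eq_bigr => j _.
  by rewrite !mxE mulrC.
have [v0 Cv0 v0nz] : exists2 v, C v & v != 0.
  have := C_chain; rewrite addn2 => -[_ [S [SC [[[w Sw] _] _] [f fS [v Cv fv]]]]].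
  have [v0|] := eqVneq v 0; last by exists v.
  exists w; first exact: SC.
  by apply: contraNneq fv => w0; rewrite v0 -w0 fS.
have [i0 xi0] : exists i0, xi 0 i0 != 0.
  have [i0 vi0] : exists i0, v0 0 i0 != 0.
    apply: contrapT => /forallNP z; case/eqP: v0nz; apply/rowP => i; rewrite mxE.
    by apply/eqP/negPn/negP/z.
  exists i0; rewrite -(mmapXU iota (xi 0)); apply/(generic_pointN _ gen).
  by exists v0; rewrite ?mevalXU.
have [f [beta [If f_nz]]] := smooth_minor (fun f If => IC If Cv0) v0nz.
pose J := map_mx ev (gradients f).
have freeJ : row_free J.
  apply: (minor_row_free (beta := beta)); rewrite -mmap_jacobian_minor.
  by apply/(generic_pointN _ gen); exists v0.
have JD : (J <= kermx Dm^T)%MS.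
  apply/sub_kermxP/matrixP => k i; rewrite !mxE.
  have : D i (ev (f k)) = 0.
    have -> : ev (f k) = 0 by apply/gen => v; apply: IC.
    exact: derivation0.
  by rewrite D_ev => e0; rewrite -[RHS]e0; apply: eq_bigr => j _; rewrite !mxE.
pose AL := map_mx iota A.
have AD : (AL <= kermx Dm^T)%MS.
  apply/sub_kermxP/matrixP => k i; rewrite !mxE.
  pose F : {mpoly K[m]} := \sum_j A k j *: 'X_j.
  have evF : ev F = \sum_j iota (A k j) * xi 0 j.
    rewrite /F /ev rmorph_sum; apply: eq_bigr => j _ /=.
    by rewrite mmapZ mmapXU.
  have : D i (ev F) = 0.
    have -> : ev F = 0; last exact: derivation0.
    apply/gen => v Cv; have /rowP/(_ k) := CA Cv; rewrite !mxE => e0.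
    rewrite -[RHS]e0 raddf_sum; apply: eq_bigr => j _ /=.
    by rewrite mevalZ mevalXU !mxE mulrC.
  rewrite evF derivation_sum // => e0; rewrite -[RHS]e0; apply: eq_bigr => j _.
  by rewrite !mxE derivationM // D_iota mul0r addr0.
have rank_cap : (e <= \rank (J :&: AL))%N.
  have := mxrank_sum_cap J AL.
  have := mxrankS (_ : J + AL <= kermx Dm^T)%MS.
  rewrite addsmx_sub JD AD => /(_ isT); rewrite mxrank_ker mxrank_tr (eqP freeD).
  rewrite (eqP freeJ) /AL mxrank_map (eqP A_free).
  have : (a + 2 <= m)%N by rewrite -(eqP freeD) rank_leq_col.
  by rewrite /e; move: mE; lia.
have [W freeW WJA] := row_free_sub rank_cap.
have /submxP[lam Wlam] := submx_trans WJA (capmxSl _ _).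
have /submxP[mu Wmu] := submx_trans WJA (capmxSr _ _).
have free_mu : row_free mu.
  by rewrite -row_leq_rank -{1}(eqP freeW) Wmu mxrankM_maxl.
have /row_freeP[rho mu_rho] := free_mu.
have [d1 [lm [d1nz lmE]]] := matrix_common_denominator (row_mx lam mu) frac.
have [d2 [rho' [d2nz rhoE]]] := matrix_common_denominator rho frac.
(* The factor ['X_i0], nonzero at the generic point, makes [mu] vanish at the origin, the one vector
   of the cone where smoothness says nothing. *)
pose lam' := 'X_i0 *: lsubmx lm; pose mu' := 'X_i0 *: rsubmx lm.
have lamE : map_mx ev lam' = (xi 0 i0 * ev d1) *: lam.
  rewrite /lam' map_mxZ /= /ev /= mmapXU map_lsubmx lmE.
  by rewrite -scalerA; congr (_ *: _); rewrite scale_row_mx row_mxKl.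
have muE : map_mx ev mu' = (xi 0 i0 * ev d1) *: mu.
  rewrite /mu' map_mxZ /= /ev /= mmapXU map_rsubmx lmE.
  by rewrite -scalerA; congr (_ *: _); rewrite scale_row_mx row_mxKr.
have ev_eq p q (B B' : 'M[{mpoly K[m]}]_(p, q)) : map_mx ev B = map_mx ev B' ->
    forall v, C v -> map_mx (meval (v 0)) B = map_mx (meval (v 0)) B'.
  move=> eB v Cv; apply/matrixP => i j; rewrite !mxE; apply/eqP.
  rewrite -subr_eq0 -mevalB; apply/eqP; move: v Cv; apply/gen.
  by move/matrixP: eB => /(_ i j); rewrite !mxE /ev /= mmapB => ->; rewrite subrr.
exists ('X_i0 * d1 * d2), lam', mu', rho', f; split=> //.
- apply/(generic_pointN _ gen); rewrite !rmorphM /= mmapXU.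
  by rewrite !mulf_neq0.
- move=> v Cv.
  have := ev_eq _ _ (mu' *m map_mx (@mpolyC m K) A) (lam' *m gradients f) _ v Cv.
  rewrite !map_mxM -!map_mx_comp /=.
  have -> : map_mx (meval (v 0) \o @mpolyC m K) A = A.
    by apply/matrixP => i j; rewrite mxE /= mevalC.
  apply; have -> : map_mx (ev \o @mpolyC m K) A = AL.
    by apply/matrixP => i j; rewrite !mxE /= mmapC.
  by rewrite lamE muE -!scalemxAl -Wmu -Wlam.
- move=> v Cv; have := ev_eq _ _ (mu' *m rho') (('X_i0 * d1 * d2)%:M) _ v Cv.
  rewrite !map_mxM !map_scalar_mx /=; apply.
  by rewrite muE rhoE -scalemxAl -scalemxAr mu_rho scalerA scale_scalar_mx mulr1
    !rmorphM /= mmapXU.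
- by apply/matrixP => i j; rewrite !mxE mevalM mevalXU mxE mul0r.
Qed.

Lemma dimension_count : (n <= a + c)%N -> (2 * a + 3 <= n + c)%N.
Proof.
move=> le_n; have e_gt0 : (0 < e)%N by rewrite /e; lia.
have [d [lam [mu [rho [f0 [If0 d_nz muA mu_rho mu0]]]]]] := normal_family.
have X_prime := has_chain_prime X_chain.
(* A point of [S] is a triple (y, x', s), with h = s mu(y) A: the normal forms at y are parametrised
   by [e] free coefficients. *)
pose S := prod_set (prod_set C X) [set: 'rV[K]_e].
have S_chain : has_chain (a + 2 + (n + 1) + e) S.
  exact: has_chain_prod (has_chain_prod C_chain X_chain) (has_chain_full K e).
pose big := (m + m + e)%N.
have [s sE] : exists s, s = (a + 2 + (n + 1) + e)%N by eexists.
rewrite -sE in S_chain.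
have [L [iota [z [gen _]]]] := generic_point_exists (has_chain_prime S_chain).
have char0L := fieldC0 iota.
have [phi [D [D_der D_iota D_phi]]] := chain_derivations char0L gen S_chain.
pose ev : {rmorphism {mpoly K[big]} -> L} := mmap iota (z 0).
have ev0 F : (forall v, S v -> F.@[v 0] = 0) -> ev F = 0 by move/gen.
have evN F (v : 'rV[K]_big) : S v -> F.@[v 0] != 0 -> ev F != 0.
  by move=> Sv Fv; apply/(generic_pointN _ gen); exists v.
pose iy (j : 'I_m) : 'I_big := lshift e (lshift m j).
pose ix (j : 'I_m) : 'I_big := lshift e (rshift m j).
pose ry : {rmorphism {mpoly K[m]} -> {mpoly K[big]}} :=
  mmap (@mpolyC big K) (fun j => 'X_(iy j)).
pose rx : {rmorphism {mpoly K[m]} -> {mpoly K[big]}} :=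
  mmap (@mpolyC big K) (fun j => 'X_(ix j)).
pose y : 'rV[L]_m := \row_j z 0 (iy j).
pose x : 'rV[L]_m := \row_j z 0 (ix j).
pose sP : 'rV[{mpoly K[big]}]_e := \row_q 'X_(rshift (m + m) q).
pose yv (v : 'rV[K]_big) : 'rV[K]_m := lsubmx (lsubmx v).
pose xv (v : 'rV[K]_big) : 'rV[K]_m := rsubmx (lsubmx v).
have ryv F (v : 'rV[K]_big) : (ry F).@[v 0] = F.@[yv v 0].
  by rewrite /ry /= meval_subst; apply: meval_eq => j; rewrite mevalXU !mxE.
have rxv F (v : 'rV[K]_big) : (rx F).@[v 0] = F.@[xv v 0].
  by rewrite /rx /= meval_subst; apply: meval_eq => j; rewrite mevalXU !mxE.
have ryL F : ev (ry F) = mmap iota (y 0) F.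
  rewrite /ev /ry /= mmap_subst; congr (mmap iota _ F).
  by apply/funext => j; rewrite mmapXU mxE.
have rxL F : ev (rx F) = mmap iota (x 0) F.
  rewrite /ev /rx /= mmap_subst; congr (mmap iota _ F).
  by apply/funext => j; rewrite mmapXU mxE.
have Iy f : I f -> mmap iota (y 0) f = 0.
  by move=> If; rewrite -ryL; apply: ev0 => v [[Cy _] _]; rewrite ryv; apply: IC.
have Ix f : I f -> mmap iota (x 0) f = 0.
  by move=> If; rewrite -rxL; apply: ev0 => v [[_ Xx] _]; rewrite rxv; apply: I_X.
(* [zP] holds the coordinates of h on the rows of [A], so that h counts for [c] coordinates of the
   target. *)
pose zP := sP *m map_mx ry mu; pose hP := zP *m map_mx (@mpolyC big K) A.
pose zL := map_mx ev zP; pose h := map_mx ev hP; pose p := y - x.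
have hE : h = zL *m map_mx iota A.
  rewrite /h /hP map_mxM -map_mx_comp; congr (_ *m _).
  by apply/matrixP => i j; rewrite !mxE /= mmapC.
have hv (v : 'rV[K]_big) : map_mx (meval (v 0)) hP =
    rsubmx v *m map_mx (meval (yv v 0)) mu *m A.
  rewrite /hP /zP !map_mxM -!map_mx_comp; congr (_ *m _ *m _).
  - by apply/rowP => q; rewrite !mxE /= mevalXU.
  - by apply/matrixP => i j; rewrite !mxE /= ryv.
  - by apply/matrixP => i j; rewrite !mxE /= mevalC.
suff : (s <= c + m)%N by rewrite sE /e; move: mE; lia.
rewrite leqNgt; apply/negP => lt_s.
(* More than c + m derivations admit a nonzero combination [tau] killing the coordinates of h and of
   p = y - x'. It remains to see that [tau] kills every entry of the generic point, against the
   duality with [phi]. *)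
pose Z := \matrix_(i < s, k < c + m) D i (row_mx zL p 0 k).
have [kap kap_nz kapZ] : exists2 kap : 'rV[L]_s, kap != 0 & kap *m Z = 0.
  have /rowV0Pn[kap /sub_kermxP] : kermx Z != 0.
    rewrite -mxrank_eq0 mxrank_ker subn_eq0 -ltnNge.
    exact: leq_ltn_trans (rank_leq_col Z) lt_s.
  by exists kap.
pose tau u := \sum_i kap 0 i * D i u.
have tau_der : derivation tau.
  split=> u v; rewrite /tau.
    rewrite -[RHS]big_split; apply: eq_bigr => i _.
    by rewrite derivationD // mulrDr.
  rewrite [X in X + _]mulr_sumr [X in _ + X]mulr_suml -[RHS]big_split.
  by apply: eq_bigr => i _; rewrite derivationM //=; ring.
have tau_iota u : tau (iota u) = 0.
  by rewrite /tau big1 // => i _; rewrite D_iota mulr0.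
have tau_row k : tau (row_mx zL p 0 k) = 0.
  have /rowP/(_ k) := kapZ; rewrite !mxE => e0; rewrite -[RHS]e0.
  by apply: eq_bigr => i _; rewrite !mxE.
have tau_z k : tau (zL 0 k) = 0 by have := tau_row (lshift m k); rewrite row_mxEl.
have tau_p j : tau (p 0 j) = 0 by have := tau_row (rshift c j); rewrite row_mxEr.
have tau_h j : tau (h 0 j) = 0.
  rewrite hE mxE derivation_sum // big1 // => k _.
  by rewrite derivationM // tau_z [map_mx iota A _ _]mxE tau_iota mulr0 mul0r addr0.
(* The form h vanishes on [C], so h(y - x') = - h(x'). Since [e] is positive some h is nonzero, and
   nondegeneracy then supplies x'. *)
have hp_neq0 : \sum_j h 0 j * p 0 j != 0.
  have [v0 Cv0 dv0] := d_nz; pose mu_v := map_mx (meval (v0 0)) mu.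
  have free_mu : row_free mu_v.
    apply/row_freeP; exists ((d.@[v0 0])^-1 *: map_mx (meval (v0 0)) rho).
    by rewrite -scalemxAr mu_rho // scale_scalar_mx mulVf.
  have [w hw] : exists w : 'rV[K]_e, w *m mu_v *m A != 0.
    exists (delta_mx 0 (Ordinal e_gt0)).
    apply/eqP; rewrite -(mul0mx _ A) => /(row_free_inj A_free).
    rewrite -(mul0mx _ mu_v) => /(row_free_inj free_mu)/rowP/(_ (Ordinal e_gt0)).
    by rewrite !mxE !eqxx => /eqP; apply/negP; exact: oner_neq0.
  have [w' Xw' hw'] := X_nondegenerate hw.
  pose v := row_mx (row_mx v0 w') w.
  have Sv : S v by rewrite /S /prod_set /v /= !row_mxKl !row_mxKr.
  have yvE : yv v = v0 by rewrite /yv /v !row_mxKl.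
  have -> : \sum_j h 0 j * p 0 j = ev (\sum_j hP 0 j * ('X_(iy j) - 'X_(ix j))).
    rewrite rmorph_sum; apply: eq_bigr => j _.
    by rewrite rmorphM rmorphB /= /ev /= !mmapXU !mxE.
  apply: (evN _ v Sv); rewrite raddf_sum /=.
  under eq_bigr => j _ do rewrite mevalM mevalB !mevalXU mulrBr.
  rewrite sumrB.
  have hPv j : (hP 0 j).@[v 0] = (w *m mu_v *m A) 0 j.
    by have /rowP/(_ j) := hv v; rewrite mxE => ->; rewrite yvE /v row_mxKr.
  rewrite [X in X - _](_ : _ = 0).
    rewrite sub0r oppr_eq0; apply: contraNneq hw' => e0; rewrite -[X in _ == X]e0.
    apply/eqP/eq_bigr => j _; rewrite hPv; congr (_ * _).
    by rewrite /v /ix row_mxEl row_mxEr.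
  have /rowP/(_ 0) : v0 *m A^T *m (w *m mu_v)^T = 0 by rewrite CA // mul0mx.
  rewrite -mulmxA -trmx_mul !mxE => e0; rewrite -[RHS]e0.
  by apply: eq_bigr => j _; rewrite hPv [in RHS]mxE mulrC /v /iy !row_mxEl.
have h_normal (f : 'I_c -> {mpoly K[m]}) beta : (forall i, I (f i)) ->
    mmap iota (y 0) (jacobian_minor f beta) != 0 ->
    (h <= map_mx (mmap iota (y 0)) (gradients f))%MS.
  move=> If nz; pose J := map_mx ry (gradients f).
  have JL : map_mx ev J = map_mx (mmap iota (y 0)) (gradients f).
    by rewrite /J -map_mx_comp; apply/matrixP => i j; rewrite !mxE /= ryL.
  have Jv (v : 'rV[K]_big) : map_mx (meval (v 0)) J = map_mx (meval (yv v 0)) (gradients f).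
    by rewrite /J -map_mx_comp; apply/matrixP => i j; rewrite !mxE /= ryv.
  (* Cramer's identity, tested at the points of [S]. Where the minor is nonzero, [f] and [f0] have
     comparable gradient spaces by smoothness; one more factor of the minor covers its zeros, and
     [mu0] covers y = 0. *)
  pose R := ry (jacobian_minor f beta) *: hP -
    colsub beta hP *m \adj (colsub beta J) *m J.
  have R0 : map_mx ev R = 0.
    apply/rowP => j; rewrite mxE [RHS]mxE; apply: (mulfI nz); rewrite mulr0 -ryL -rmorphM.
    apply: ev0 => v [[Cy _] _]; rewrite mevalM ryv.
    have [->|nzv] := eqVneq ((jacobian_minor f beta).@[yv v 0]) 0; first by rewrite mul0r.
    have hJ : (map_mx (meval (v 0)) hP <= map_mx (meval (v 0)) J)%MS.
      rewrite hv Jv; have [y0|ynz] := eqVneq (yv v) 0.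
        by rewrite y0 mu0 mulmx0 mul0mx sub0mx.
      rewrite -mulmxA muA // mulmxA; apply: submx_trans (submxMl _ _) _.
      by apply: (smooth_sub _ ynz If If0 nzv) => g Ig; apply: IC.
    have : map_mx (meval (v 0)) R = 0.
      rewrite /R map_mxB map_mxZ [map_mx _ (_ *m J)]map_mxM.
      rewrite [map_mx _ (_ *m \adj _)]map_mxM map_mx_adj !map_mxsub /=.
      rewrite -cramer_submx // ryv Jv.
      have -> : (jacobian_minor f beta).@[yv v 0] =
          \det (colsub beta (map_mx (meval (yv v 0)) (gradients f))).
        exact: (mmap_jacobian_minor idfun).
      by rewrite subrr.
    by move=> /rowP/(_ j); rewrite mxE [RHS]mxE => ->; rewrite mulr0.
  have nz' : ev (ry (jacobian_minor f beta)) != 0 by rewrite ryL.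
  move: R0; rewrite /R map_mxB map_mxZ [map_mx _ (_ *m J)]map_mxM /=.
  move=> /eqP; rewrite subr_eq0 => /eqP e0.
  rewrite -JL -[h](scalerK nz') /h e0; apply: scalemx_sub; exact: submxMl.
have Iyp f : I f -> mmap iota ((y - p) 0) f = 0 by rewrite subKr; apply: Ix.
have Ism (v : 'rV[K]_m) : (forall f, I f -> f.@[v 0] = 0) ->
    (forall (f : 'I_c -> {mpoly K[m]}) beta, (forall i, I (f i)) ->
     (jacobian_minor f beta).@[v 0] = 0) -> v = 0.
  move=> Iv minors; apply/eqP/contraT => vnz.
  have [f [beta [If]]] := smooth_minor Iv vnz.
  by rewrite minors ?eqxx.
have tau_y := integral_over_constants char0L tau_der tau_iota I_homog Iy Iyp tau_p
  tau_h hp_neq0 Ism h_normal.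
have tau_x j : tau (x 0 j) = 0.
  have -> : x 0 j = y 0 j - p 0 j by rewrite /p [(y - x) 0 j]mxE [(- x) 0 j]mxE opprB addrC subrK.
  by rewrite derivationB // tau_y tau_p subrr.
pose sL := map_mx ev sP; pose muL := map_mx ev (map_mx ry mu).
have tau_mu q k : tau (muL q k) = 0.
  rewrite /muL !mxE ryL (derivation_mmap tau_der) // big1 // => j _.
  by rewrite tau_y mulr0.
have ev_mat p1 q1 (B B' : 'M[{mpoly K[m]}]_(p1, q1)) :
    (forall v, C v -> map_mx (meval (v 0)) B = map_mx (meval (v 0)) B') ->
    map_mx ev (map_mx ry B) = map_mx ev (map_mx ry B').
  move=> eB; apply/matrixP => i j; rewrite !mxE; apply/eqP; rewrite -subr_eq0 -!rmorphB.
  apply/eqP/ev0 => v [[Cy _] _]; rewrite ryv mevalB.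
  by move/matrixP: (eB _ Cy) => /(_ i j); rewrite !mxE => ->; rewrite subrr.
(* Both s mu and mu are killed by [tau], hence tau(s) mu = 0, and [rho] inverts mu up to the nonzero
   factor [d]. *)
have tau_s q : tau (sL 0 q) = 0.
  pose ts := \row_q tau (sL 0 q).
  have ts_mu : ts *m muL = 0.
    apply/rowP => k; rewrite mxE [RHS]mxE -[RHS](tau_z k) /zL /zP map_mxM -/sL -/muL.
    rewrite [in RHS]mxE derivation_sum //; apply: eq_bigr => r _.
    by rewrite derivationM // tau_mu mulr0 add0r [in LHS]mxE.
  have d_nz' : ev (ry d) != 0.
    have [v0 Cv0 dv0] := d_nz; have [w Xw] := X_prime.1.
    apply: (evN _ (row_mx (row_mx v0 w) 0)); last by rewrite ryv /yv !row_mxKl.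
    by split=> //; rewrite row_mxKl; split; rewrite ?row_mxKl ?row_mxKr.
  have mrL : muL *m map_mx ev (map_mx ry rho) = (ev (ry d))%:M.
    rewrite /muL -!map_mxM (ev_mat _ _ _ d%:M) ?map_scalar_mx // => v Cv.
    by rewrite map_mxM map_scalar_mx mu_rho.
  have : ts *m muL *m map_mx ev (map_mx ry rho) = 0 by rewrite ts_mu mul0mx.
  rewrite -mulmxA mrL mul_mx_scalar => /eqP.
  rewrite scaler_eq0 (negbTE d_nz') => /eqP/rowP/(_ q).
  by rewrite mxE [RHS]mxE.
have tau_gen i : tau (z 0 i) = 0.
  case: (split_ordP i) => [j ->|q ->].
    case: (split_ordP j) => [k ->|k ->].
      by have := tau_y k; rewrite mxE.
    by have := tau_x k; rewrite mxE.
  by have := tau_s q; rewrite !mxE /ev /= mmapXU.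
case/eqP: kap_nz; apply/rowP => j; rewrite [RHS]mxE.
have : tau (mmap iota (z 0) (phi j)) = 0.
  by rewrite (derivation_mmap tau_der) // big1 // => i _; rewrite tau_gen mulr0.
rewrite /tau (bigD1 j) //= D_phi eqxx mulr1 big1 ?addr0 // => i ij.
by rewrite D_phi (negbTE ij) mulr0.
Qed.

End DimensionCount.

(** * Cones over irreducible sets of points and of lines *)

Section ZariskiCones.
Variable K : closedFieldType.

Lemma meval_homog m d (F : {mpoly K[m]}) (s : K) (w : 'rV[K]_m) :
  F \is d.-homog -> F.@[(s *: w) 0] = s ^+ d * F.@[w 0].
Proof. exact: (mmap_homog idfun). Qed.

(** F(s w) is a polynomial in s whose coefficients are the homogeneous components of F at w, and [K]
    is infinite. *)
Lemma vanishing_on_line m (F : {mpoly K[m]}) (w : 'rV[K]_m) :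
  (forall s, F.@[(s *: w) 0] = 0) <-> forall d, (pihomog mdeg d F).@[w 0] = 0.
Proof.
have FE k s : (msize F <= k)%N ->
    F.@[(s *: w) 0] = \sum_(d < k) s ^+ d * (pihomog mdeg d F).@[w 0].
  move=> le_k; rewrite {1}(@pihomog_partitionE _ _ mdeg k F le_k) raddf_sum.
  by apply: eq_bigr => d _; apply: meval_homog; apply: pihomogP.
split=> [F0 d|F0 s]; last by rewrite (FE _ _ (leqnn _)) big1 // => d _; rewrite F0 mulr0.
pose k := maxn (msize F) d.+1.
pose P := \poly_(i < k) (pihomog mdeg i F).@[w 0].
have P0 : P = 0.
  apply/eqP/contraT => /closed_nonrootP[s /rootP].
  rewrite /P horner_poly => -[]; rewrite -[RHS](F0 s) (FE k) ?leq_maxl //.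
  by apply: eq_bigr => i _; rewrite mulrC.
have := congr1 (fun Q : {poly K} => Q`_d) P0.
by rewrite coef_poly coef0 leq_max ltnSn orbT.
Qed.

Variable N : nat.

Lemma mem_proj (p : proj K N) v : v \in val p <-> exists s, v = s *: homcoord p.
Proof.
have -> : val p = <[homcoord p]>%VS.
  apply/esym/eqP; rewrite eqEdim (eqP (valP p)) dim_vline.
  rewrite -memvE memv_pick; rewrite /homcoord vpick0 -dimv_eq0 (eqP (valP p)).
  by [].
by split=> [/vlineP[s ->]|[s ->]]; [exists s|apply/vlineP; exists s].
Qed.

Lemma homcoord_neq0 (p : proj K N) : homcoord p != 0.
Proof. by rewrite /homcoord vpick0 -dimv_eq0 (eqP (valP p)). Qed.

Definition line_u (l : line K N) : 'rV[K]_N.+1 := (vbasis (val l))`_0.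
Definition line_v (l : line K N) : 'rV[K]_N.+1 := (vbasis (val l))`_1.

Lemma line_basis (l : line K N) : row_free (col_mx (line_u l) (line_v l)) /\
  forall w, w \in val l <-> exists a b, w = a *: line_u l + b *: line_v l.
Proof.
have := vbasisP (val l); rewrite /line_u /line_v.
move: (vbasis (val l)); rewrite (eqP (valP l)) => X /andP[/eqP spanX freeX].
have sum2 (c : 'I_2 -> K) : \sum_i c i *: X`_i = c 0 *: X`_0 + c 1 *: X`_1.
  by rewrite !big_ord_recl big_ord0 addr0; congr (_ + c _ *: _); apply: val_inj.
split.
  apply: inj_row_free => k; rewrite -[k]hsubmxK mul_row_col.
  rewrite [lsubmx k]mx11_scalar [rsubmx k]mx11_scalar !mul_scalar_mx => k0.
  pose c (i : 'I_2) := if i == 0 then lsubmx k 0 0 else rsubmx k 0 0.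
  have /freeP/(_ c) := freeX; rewrite sum2 => /(_ k0) c0.
  have := c0 0; rewrite /c /= => ->; have := c0 1; rewrite /c /= => ->.
  by rewrite !raddf0 row_mx0.
rewrite -spanX => w; split=> [wX|[a [b ->]]].
  by exists (coord X 0 w), (coord X 1 w); rewrite {1}(coord_span wX) sum2.
by apply: memvD; apply: memvZ; apply: memv_span; apply: mem_nth; rewrite size_tuple.
Qed.

Definition plucker_mx (l : line K N) : 'M[K]_N.+1 := vec_mx (plucker l).

Lemma plucker_mxE l :
  plucker_mx l = (line_u l)^T *m line_v l - (line_v l)^T *m line_u l.
Proof. exact: mxvecK. Qed.

(** The antisymmetric matrix of Plucker coordinates has the plane of the line as its row space, so
    the vectors of a line depend linearly on these coordinates. *)
Lemma mem_line (l : line K N) v : v \in val l <-> exists mu : 'rV_N.+1, v = mu *m plucker_mx l.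
Proof.
have [free memE] := line_basis l; rewrite memE plucker_mxE.
set u := line_u l in free *; set w := line_v l in free *.
have muE (mu : 'rV_N.+1) : mu *m (u^T *m w - w^T *m u) =
    (mu *m u^T) 0 0 *: w - (mu *m w^T) 0 0 *: u.
  rewrite mulmxBr !mulmxA [mu *m u^T]mx11_scalar [mu *m w^T]mx11_scalar.
  by rewrite !mul_scalar_mx -!mx11_scalar.
split=> [[a [b ->]]|[mu ->]]; last first.
  rewrite muE; exists (- (mu *m w^T) 0 0), ((mu *m u^T) 0 0).
  by rewrite scaleNr addrC.
have /row_freeP[B BE] := free.
exists (row_mx b%:M (- a)%:M *m B^T); rewrite muE.
have eB : B^T *m (row_mx u^T w^T) = 1%:M by rewrite -tr_col_mx -trmx_mul BE trmx1.
have := congr1 (mulmx (row_mx b%:M (- a)%:M)) eB.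
rewrite mulmx1 mulmxA mul_mx_row => /eq_row_mx[-> ->].
by rewrite !mxE /= !mulr1n scaleNr opprK addrC.
Qed.

(** For lines through a fixed point, wedging with [x] recovers the Plucker vector from a vector of
    the line, so conditions on lines pull back to conditions on vectors of the cone. *)
Lemma plucker_wedge (l : line K N) (x : 'rV[K]_N.+1) : x \in val l -> x != 0 ->
  (forall y, y \in val l -> exists s, mxvec (x^T *m y - y^T *m x) = s *: plucker l) /\
  exists y s, [/\ y \in val l, s != 0 & mxvec (x^T *m y - y^T *m x) = s *: plucker l].
Proof.
have [free memE] := line_basis l.
have wedge a b c d : mxvec ((a *: line_u l + b *: line_v l)^T *m
      (c *: line_u l + d *: line_v l) - (c *: line_u l + d *: line_v l)^T *m
      (a *: line_u l + b *: line_v l)) = (a * d - b * c) *: plucker l.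
  rewrite /plucker -linearZ; congr mxvec; apply/matrixP => i j; rewrite !mxE.
  by rewrite !big_ord1 !mxE; ring.
move=> /memE[a [b ->]] xnz; split.
  by move=> y /memE[c [d ->]]; exists (a * d - b * c).
have [a0|anz] := eqVneq a 0.
  have bnz : b != 0 by apply: contraNneq xnz => ->; rewrite a0 !scale0r addr0.
  exists (1 *: line_u l + 0 *: line_v l), (a * 0 - b * 1); split=> //.
  - by apply/memE; exists 1, 0.
  - by rewrite mulr0 mulr1 sub0r oppr_eq0.
exists (0 *: line_u l + 1 *: line_v l), (a * 1 - b * 0); split=> //.
- by apply/memE; exists 0, 1.
- by rewrite mulr0 mulr1 subr0.
Qed.

Lemma plucker_neq0 (l : line K N) : plucker l != 0.
Proof.
have [u ul unz] : exists2 u, u \in val l & u != 0.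
  exists (vpick (val l)); first exact: memv_pick.
  by rewrite vpick0 -dimv_eq0 (eqP (valP l)).
apply: contraNneq unz => p0; have /mem_line[mu ->] := ul.
by rewrite /plucker_mx p0 linear0 mulmx0.
Qed.

Lemma prime_set_vspace m (V : {vspace 'rV[K]_m}) : prime_set [set v | v \in V].
Proof.
have [B [_ BE]] := vspace_mx V.
have := prime_set_sum B (0 : 'M_(0, m)) (has_chain_prime (has_chain_full K _))
  (has_chain_prime (has_chain_full K 0)).
congr prime_set; apply/seteqP; split=> [_ [s [t [_ _ ->]]]|v] /=.
  by rewrite mulmx0 addr0 BE submxMl.
by rewrite BE => /submxP[D ->]; exists D, 0; rewrite mulmx0 addr0.
Qed.

(** Closed sets are cut out by homogeneous polynomials; a family stable under rescaling its argument
    can be replaced by its homogeneous components. *)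
Lemma scaling_family_closed m T (coord : T -> 'rV[K]_m) (G : set {mpoly K[m]}) :
  (forall F s, G F -> exists2 F', G F' & forall w : 'rV_m, F'.@[w 0] = F.@[(s *: w) 0]) ->
  exists2 S : set {mpoly K[m]}, S `<=` @homogeneous K m &
    [set t | forall F, G F -> F.@[coord t 0] = 0] = zero_locus coord S.
Proof.
move=> Gs; exists [set H | exists F d, G F /\ H = pihomog mdeg d F].
  by move=> _ [F [d [_ ->]]]; exists d; apply: pihomogP.
apply/seteqP; split=> [t tG _ [F [d [GF ->]]]|t tG F GF].
  move: d; apply/vanishing_on_line => s; have [F' GF' <-] := Gs F s GF.
  exact: tG.
have := vanishing_on_line F (coord t); case=> _ /(_ _)/(_ 1); rewrite scale1r; apply.
by move=> d; apply: tG; exists F, d.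
Qed.

Lemma proj_vanishing_closed (F : {mpoly K[N.+1]}) :
  closed [set p : proj K N | forall v, v \in val p -> F.@[v 0] = 0].
Proof.
apply/proj_closedE.
have scale s : exists G : {mpoly K[N.+1]}, forall w : 'rV_N.+1, G.@[w 0] = F.@[(s *: w) 0].
  have [G GE] := affine_substitution (s%:M : 'M[K]_N.+1) 0 F.
  by exists G => w; rewrite GE addr0 mul_mx_scalar.
have [|S hS eS] := @scaling_family_closed N.+1 (proj K N) (@homcoord K N)
  [set G | exists s, forall w : 'rV_N.+1, G.@[w 0] = F.@[(s *: w) 0]].
  move=> G t [s Gs]; have [G' GE] := scale (s * t).
  by exists G' => [|w]; [exists (s * t)|rewrite GE Gs scalerA].
exists S => //; rewrite -eS; apply/seteqP; split=> [p pF G [s ->]|p pG v /mem_proj[s ->]].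
  by apply: pF; apply/mem_proj; exists s.
by have [G GE] := scale s; rewrite -GE; apply: pG; exists s.
Qed.

Lemma line_vanishing_closed (F : {mpoly K[N.+1]}) :
  closed [set l : line K N | forall v, v \in val l -> F.@[v 0] = 0].
Proof.
apply/line_closedE.
have subst (mu : 'rV_N.+1) : exists G : {mpoly K[N.+1 * N.+1]},
    forall w : 'rV_(N.+1 * N.+1), G.@[w 0] = F.@[(mu *m vec_mx w) 0].
  have [G GE] := affine_substitution (lin1_mx (mulmx mu \o vec_mx)) 0 F.
  by exists G => w; rewrite GE addr0 mul_rV_lin1.
have [|S hS eS] := @scaling_family_closed _ (line K N) (@plucker K N)
  [set G | exists mu : 'rV_N.+1, forall w : 'rV_(N.+1 * N.+1),
     G.@[w 0] = F.@[(mu *m vec_mx w) 0]].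
  move=> G t [mu Gmu]; have [G' GE] := subst (t *: mu).
  exists G' => [|w]; first by exists (t *: mu).
  by rewrite GE Gmu linearZ -scalemxAl scalemxAr.
exists S => //; rewrite -eS; apply/seteqP; split=> [l lF G [mu ->]|l lG v /mem_line[mu ->]].
  by apply: lF; apply/mem_line; exists mu.
by have [G GE] := subst mu; rewrite -GE; apply: lG; exists mu.
Qed.

Section Cones.
Variables (T : topologicalType) (sp : T -> {vspace 'rV[K]_N.+1}).
Hypothesis vanishing_closed : forall F : {mpoly K[N.+1]},
  closed [set t | forall v, v \in sp t -> F.@[v 0] = 0].

Definition cone (Z : set T) : set 'rV[K]_N.+1 := [set v | exists2 t, Z t & v \in sp t].

(** The [t] whose linear space lies in the zeros of F form a closed set. Irreducibility gives one
    [t] on whose space neither F nor G vanishes identically, and a linear space is itself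
    irreducible. *)
Lemma irreducible_cone Z : irreducible Z -> prime_set (cone Z).
Proof.
move=> [[t0 Zt0] irr]; split; first by exists 0, t0; rewrite ?mem0v.
move=> F G [v [t Zt vt] Fv] [w [t' Zt' wt'] Gw].
have [t1 [Zt1 F1 G1]] : exists t1, [/\ Z t1, nonvanishing F [set v | v \in sp t1] &
    nonvanishing G [set v | v \in sp t1]].
  apply: contrapT => none.
  have [|ZF|ZG] := irr _ _ (@vanishing_closed F) (@vanishing_closed G).
  - move=> t1 Zt1; apply: contrapT => /not_orP[nF nG]; apply: none; exists t1; split=> //.
      move/existsNP: nF => [u /not_implyP[ut /eqP Fu]]; by exists u.
    move/existsNP: nG => [u /not_implyP[ut /eqP Gu]]; by exists u.
  - by move: Fv; rewrite (ZF _ Zt) ?eqxx.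
  - by move: Gw; rewrite (ZG _ Zt') ?eqxx.
have [u [ut Fu Gu]] := (prime_set_vspace (sp t1)).2 F G F1 G1.
by exists u; split=> //; exists t1.
Qed.

Variables (B : set T) (P : set 'rV[K]_N.+1) (k0 : nat).
Hypothesis P_chain : has_chain k0 P.
Hypothesis P_sub : forall t v, B t -> P v -> v \in sp t.
Hypothesis P_separated : forall t, B t -> exists2 f : {mpoly K[N.+1]},
  (forall v, P v -> f.@[v 0] = 0) & nonvanishing f [set v | v \in sp t].
Hypothesis closed_separated : forall C t, closed C -> B t -> ~ C t ->
  exists2 f : {mpoly K[N.+1]},
    (forall t' v, B t' -> C t' -> v \in sp t' -> f.@[v 0] = 0) &
    nonvanishing f [set v | v \in sp t].

(** [P] is the common vertex of the cones: the origin for points, the line of x for lines through x.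
    Its own chain, of length [k0], is glued below the cone over Z 0, at the cost of one more strict
    inclusion. *)
Lemma irreducible_chain_cone S k Z : S `<=` B -> irreducible_chain S k Z ->
  has_chain (k0 + 1 + k) (cone (Z k)).
Proof.
move=> SB [Zirr Zlt]; have ZS i : (i <= k)%N -> Z i `<=` S.
  by move=> /Zirr[_ ->] t [].
elim: {1 3 4}k (leqnn k) => [|i IH] le_i.
  rewrite addn0 addn1; have [irr _] := Zirr 0%N (leq0n k).
  split; first exact: irreducible_cone.
  have [t Zt] := irr.1; have Bt : B t by apply/SB/(ZS 0%N (leq0n k)).
  exists P; split=> //; first by move=> v Pv; exists t => //; apply: P_sub.
  by have [f fP [v tv fv]] := P_separated Bt; exists f => //; exists v => //; exists t.
rewrite addnS; have [irr _] := Zirr _ le_i; split; first exact: irreducible_cone.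
have [ZZ nZZ] := Zlt _ le_i.
exists (cone (Z i)); split; [by move=> v [t /ZZ Zt tv]; exists t| exact: IH (ltnW le_i)|].
have [t [Zt nZt]] : exists t, Z i.+1 t /\ ~ Z i t.
  by apply: contrapT => none; apply: nZZ => t Zt; apply: contrapT => ?; apply: none; exists t.
have St : S t by apply: ZS Zt.
have [||f fC [v tv fv]] := @closed_separated (closure (Z i)) t (@closed_closure _ _).
- exact: SB.
- by move=> clt; apply: nZt; have [_ ->] := Zirr _ (ltnW le_i).
exists f; last by exists v => //; exists t.
move=> w [t' Zt' wt']; apply: (fC t') => //; last exact: subset_closure.
by apply: SB; apply: ZS Zt'; apply: ltnW.
Qed.

End Cones.

Lemma has_chain_enlarge m k (S S' : set 'rV[K]_m) : S' `<=` S -> prime_set S ->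
  has_chain k.+1 S' -> has_chain k.+1 S.
Proof.
move=> S'S hS [_ [S'' [S''S' chain [f fS'' [v S'v fv]]]]]; split=> //.
exists S''; split=> //; first by move=> w /S''S'/S'S.
by exists f => //; exists v => //; apply: S'S.
Qed.

Lemma proj_cone_chain (X : set (proj K N)) k Z : irreducible X ->
  irreducible_chain X k Z -> has_chain (k + 1) (cone (fun p : proj K N => val p) X).
Proof.
move=> irrX chainX; rewrite addn1.
apply: (@has_chain_enlarge _ _ _ (cone (fun p : proj K N => val p) (Z k))).
- move=> v [p Zp vp]; exists p => //.
  by have [_ eZ] := chainX.1 k (leqnn k); move: Zp; rewrite eZ => -[].
- exact: irreducible_cone proj_vanishing_closed _ irrX.
rewrite -[k.+1]/(0 + 1 + k)%N.
apply: (irreducible_chain_cone proj_vanishing_closed (B := setT) (P := [set 0])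
  _ _ _ _ _ chainX) => //.
- by split=> //; apply: prime_set0.
- by move=> p v _ ->; apply: mem0v.
- move=> p _; have [i pi] : exists i, homcoord p 0 i != 0.
    apply: contrapT => /forallNP z; case/eqP: (homcoord_neq0 p); apply/rowP => i.
    by rewrite mxE; apply/eqP/negPn/negP/z.
  exists 'X_i; first by move=> _ ->; rewrite mevalXU mxE.
  by exists (homcoord p); rewrite ?mevalXU //; apply/mem_proj; exists 1; rewrite scale1r.
move=> C p /proj_closedE[S hS ->] _ /existsNP[f /not_implyP[Sf /eqP fp]].
have [d fd] := hS f Sf; exists f.
  move=> q v _ qC /mem_proj[s ->]; rewrite (meval_homog _ _ fd).
  by rewrite [X in _ * X](qC f Sf) mulr0.
by exists (homcoord p) => //; apply/mem_proj; exists 1; rewrite scale1r.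
Qed.

Lemma line_cone_chain (S : set (line K N)) (x : proj K N) k Z :
  S `<=` (fun l => on_line x l) -> irreducible_chain S k Z ->
  has_chain (k + 2) (cone (fun l : line K N => val l) (Z k)).
Proof.
move=> Sx chainS; pose x0 := homcoord x.
pose W := lin1_mx (mxvec \o mulmx x0^T) - lin1_mx (mxvec \o (mulmxr x0 \o trmx)).
have WE y : y *m W = mxvec (x0^T *m y - y^T *m x0).
  by rewrite mulmxBr !mul_rV_lin1 /= linearB.
have xl l : on_line x l -> x0 \in val l.
  by move=> xl; apply: (subvP xl); apply/mem_proj; exists 1; rewrite scale1r.
have pull (F : {mpoly K[N.+1 * N.+1]}) : exists f : {mpoly K[N.+1]},
    forall y : 'rV_N.+1, f.@[y 0] = F.@[mxvec (x0^T *m y - y^T *m x0) 0].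
  by have [f fE] := affine_substitution W 0 F; exists f => y; rewrite fE addr0 WE.
rewrite addnC; apply: (irreducible_chain_cone line_vanishing_closed
  (B := fun l => on_line x l) (P := range (fun t => t *: x0)) (k0 := 1%N)
  _ _ _ _ Sx chainS).
- exact: has_chain_line (homcoord_neq0 x).
- by move=> l v /xl lx [t _ <-]; apply: memvZ.
- move=> l /xl lx; have [i li] : exists i, plucker l 0 i != 0.
    apply: contrapT => /forallNP z; case/eqP: (plucker_neq0 l); apply/rowP => i.
    by rewrite mxE; apply/eqP/negPn/negP/z.
  have [f fE] := pull 'X_i; exists f.
    move=> _ [t _ <-]; rewrite fE mevalXU.
    have -> : x0^T *m (t *: x0) - (t *: x0)^T *m x0 = 0.
      by apply/matrixP => r q; rewrite !mxE !big_ord1 !mxE; ring.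
    by rewrite linear0 mxE.
  have [_ [y [s [ly snz e]]]] := plucker_wedge lx (homcoord_neq0 x).
  by exists y; rewrite // fE mevalXU e mxE mulf_neq0.
move=> C l /line_closedE[S' hS ->] /xl lx /existsNP[F /not_implyP[SF /eqP Fl]].
have [d Fd] := hS F SF; have [f fE] := pull F; exists f.
  move=> l' v /xl lx' l'C vl'; rewrite fE.
  have [/(_ v vl')[s ->] _] := plucker_wedge lx' (homcoord_neq0 x).
  by rewrite (meval_homog _ _ Fd) [X in _ * X](l'C F SF) mulr0.
have [_ [y [s [ly snz e]]]] := plucker_wedge lx (homcoord_neq0 x).
by exists y; rewrite // fE e (meval_homog _ _ Fd) mulf_neq0 ?expf_neq0.
Qed.

End ZariskiCones.

(** * Smoothness, non-degeneracy and tangency on the cone over X *)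

Section TangentCones.
Variables (K : closedFieldType) (N : nat) (X : set (proj K N)).
Local Notation hull := (cone (fun p : proj K N => val p) X).
Local Notation IX := (homogeneous_ideal X).

Lemma proj_through (v : 'rV[K]_N.+1) : v != 0 -> exists p : proj K N,
  val p = <[v]>%VS /\ exists2 s, s != 0 & v = s *: homcoord p.
Proof.
move=> vnz; have d1 : \dim <[v]>%VS == 1%N by rewrite dim_vline vnz.
exists (exist _ <[v]>%VS d1); split=> //.
have /mem_proj[s e] : v \in val (exist _ <[v]>%VS d1 : proj K N) by apply: memv_line.
by exists s => //; apply: contraNneq vnz => s0; rewrite e s0 scale0r.
Qed.

Lemma homogeneous_ideal_hull f v : IX f -> hull v -> f.@[v 0] = 0.
Proof.
move=> [[d fd] fX] [p Xp /mem_proj[s ->]].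
by rewrite (meval_homog _ _ fd) fX ?mulr0.
Qed.

Lemma homogeneous_ideal_zero (v : 'rV[K]_N.+1) : closed X -> v != 0 ->
  (forall f, IX f -> f.@[v 0] = 0) ->
  exists p s, [/\ X p, s != 0 & v = s *: homcoord p].
Proof.
move=> /proj_closedE[S hS eX] vnz Iv; have [p [_ [s snz e]]] := proj_through vnz.
exists p, s; split=> //; rewrite eX => f Sf; have [d fd] := hS f Sf.
have /eqP : f.@[v 0] = 0.
  apply: Iv; split; first exact: hS.
  by move=> q; rewrite eX => /(_ f Sf).
by rewrite e (meval_homog _ _ fd) mulf_eq0 expf_eq0 (negbTE snz) andbF => /eqP.
Qed.

Lemma smooth_at_vector n (v : 'rV[K]_N.+1) : closed X -> smooth X n ->
  (forall f, IX f -> f.@[v 0] = 0) -> v != 0 ->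
  exists2 T : {vspace 'rV[K]_N.+1}, \dim T = n.+1 & forall u, u \in T <->
    forall f, IX f -> \sum_i f^`M(i).@[v 0] * u 0 i = 0.
Proof.
move=> clX smX Iv vnz; have [p [s [Xp snz ->]]] := homogeneous_ideal_zero clX vnz Iv.
have [T dT TP] := smX p Xp; exists T => // u; rewrite TP.
have eqd f : IX f -> exists2 r, r != 0 &
    \sum_i f^`M(i).@[(s *: homcoord p) 0] * u 0 i =
    r * \sum_i f^`M(i).@[homcoord p 0] * u 0 i.
  move=> [[d fd] _]; exists (s ^+ d.-1); first exact: expf_neq0.
  rewrite mulr_sumr; apply: eq_bigr => i _.
  by rewrite (meval_homog _ _ (mderiv_homog i fd)) mulrA.
split=> uT f If; have [r rnz e] := eqd f If.
  by rewrite e (uT f If) mulr0.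
by apply: (mulfI rnz); rewrite mulr0 -e uT.
Qed.

Lemma non_degenerate_hull (h : 'rV[K]_N.+1) : non_degenerate X -> h != 0 ->
  exists2 v, hull v & \sum_i h 0 i * v 0 i != 0.
Proof.
move=> ndX hnz; pose g : {linear 'rV[K]_N.+1 -> 'rV[K]_1} := mulmxr h^T.
pose H := lker (linfun g).
have dimH : \dim H = N.
  have := limg_ker_dim (linfun g) fullv; rewrite capfv !dimvf /dim /= mul1n.
  have -> : \dim (limg (linfun g)) = 1%N; last by rewrite addn1 => -[].
  apply/eqP; rewrite eqn_leq; apply/andP; split.
    by apply: leq_trans (dimvS (subvf _)) _; rewrite dimvf /dim /= mul1n.
  rewrite lt0n dimv_eq0; apply: contraNneq hnz => img0.
  apply/eqP/rowP => i; rewrite mxE.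
  have : linfun g (delta_mx 0 i) \in limg (linfun g) by apply: memv_img; apply: memvf.
  rewrite img0 memv0 lfunE /= => /eqP/rowP/(_ 0); rewrite !mxE => e; rewrite -[RHS]e.
  rewrite (bigD1 i) //= !mxE !eqxx mul1r big1 ?addr0 // => j ji.
  by rewrite !mxE (negbTE ji) andbF mul0r.
have [p Xp npH] := ndX H dimH; exists (homcoord p).
  by exists p => //; apply/mem_proj; exists 1; rewrite scale1r.
apply: contra npH => /eqP e; apply/subvP => v /mem_proj[s ->]; apply: memvZ.
rewrite memv_ker lfunE /=; apply/eqP/rowP => i; rewrite ord1 !mxE -[RHS]e.
by apply: eq_bigr => j _; rewrite mxE mulrC.
Qed.

(* The derivative of f along the line at x is the linear coefficient of the
   restriction of f to the line, which vanishes identically. *)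
Lemma derivative_along_line m (f : {mpoly K[m]}) (x v : 'rV[K]_m) :
  (forall t, f.@[(x + t *: v) 0] = 0) -> \sum_i f^`M(i).@[x 0] * v 0 i = 0.
Proof.
move=> f0; pose q (F : {mpoly K[m]}) : {poly K} :=
  mmap (@polyC K) (fun i => (x 0 i)%:P + v 0 i *: 'X) F.
have qE F t : (q F).[t] = F.@[(x + t *: v) 0].
  apply: (@mpoly_rmorph_ext K K m (horner_eval t \o mmap (@polyC K) _) (meval _)) => [c|i] /=.
    by rewrite mmapC mevalC /horner_eval hornerC.
  by rewrite mmapXU mevalXU /horner_eval hornerD hornerZ hornerX hornerC !mxE mulrC.
have q'E F : (q F)^`().[0] = \sum_i F^`M(i).@[x 0] * v 0 i.
  have q0 G : (q G).[0] = G.@[x 0] by rewrite qE scale0r addr0.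
  elim/mpoly_ring_ind: F => [c|i|F G eF eG|F G eF eG].
  - rewrite /q mmapC derivC horner0 big1 // => i _; rewrite mderivC meval0 mul0r //.
  - rewrite /q mmapXU derivD derivC derivZ derivX add0r hornerZ hornerC mulr1.
    rewrite (bigD1 i) //= mderivXU eqxx mevalC mul1r big1 ?addr0 // => j ji.
    by rewrite mderivXU eq_sym (negbTE ji) mevalC mul0r.
  - rewrite /q rmorphD derivD hornerD -!/(q _) eF eG -big_split; apply: eq_bigr => i _.
    by rewrite mderivD mevalD mulrDl.
  - rewrite /q rmorphM derivM hornerD !hornerM -!/(q _) eF eG !q0.
    rewrite [X in X + _]mulr_suml [X in _ + X]mulr_sumr -big_split.
    by apply: eq_bigr => i _; rewrite mderivM mevalD !mevalM /=; ring.
rewrite -q'E; have -> : q f = 0; last by rewrite deriv0 horner0.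
apply/eqP/contraT => /closed_nonrootP[t /rootP].
by rewrite qE f0.
Qed.

End TangentCones.

(** * The bound at a point, and the inequality *)

Lemma lines_through_point_bound (K : closedFieldType) N n c a
    (X : set (proj K N)) (L : set (line K N)) (x : proj K N) :
  (forall k, k.+1%:R != 0 :> K) ->
  projective_variety X -> has_dim X n -> smooth X n -> non_degenerate X ->
  N = (n + c)%N -> L `<=` lines_in X -> X x -> has_dim (lines_through L x) a ->
  (n <= a + c)%N -> (2 * a + 3 <= n + c)%N.
Proof.
move=> char0 [clX irrX] [[Z chainZ] _] smX ndX NE LX Xx [[Y chainY] _].
have NE' : N.+1 = (n + 1 + c)%N by rewrite NE; lia.
have x_hull : cone (fun p : proj K N => val p) X (homcoord x).
  by exists x => //; apply/mem_proj; exists 1; rewrite scale1r.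
have [T dT TP] := smX x Xx.
pose G : set 'rV[K]_N.+1 :=
  [set g | exists2 f, homogeneous_ideal X f & g = \row_i f^`M(i).@[homcoord x 0]].
have GT u : u \in T <-> forall g, G g -> u *m g^T = 0.
  rewrite TP; split=> [uT _ [f If ->]|uT f If].
    apply/rowP => i; rewrite !mxE -[RHS](uT f If); apply: eq_bigr => j _.
    by rewrite !mxE mulrC.
  have := uT _ (ex_intro2 _ _ f If erefl) => /rowP/(_ 0); rewrite !mxE => e.
  by rewrite -[RHS]e; apply: eq_bigr => j _; rewrite !mxE mulrC.
have dimT : (\dim T + c)%N = N.+1 by rewrite dT NE; lia.
have [A [GA freeA]] := normal_space_basis dimT GT.
pose C := cone (fun l : line K N => val l) (Y a).
have YL : Y a `<=` lines_through L x.
  by move=> l; have [_ ->] := chainY.1 a (leqnn a); case.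
have line_hull l v : lines_through L x l -> v \in val l ->
    cone (fun p : proj K N => val p) X v.
  move=> [Ll xl] vl; have [->|vnz] := eqVneq v 0; first by exists x; rewrite ?mem0v.
  have [p [pv _]] := proj_through vnz; exists p; last by rewrite pv memv_line.
  by apply: (LX l Ll); rewrite /on_line pv -memvE.
apply: (@dimension_count K char0 N.+1 n c a (homogeneous_ideal X)
  (cone (fun p : proj K N => val p) X) C A NE') => //.
- by move=> f [].
- by move=> f If v; apply: homogeneous_ideal_hull.
- by move=> v; apply: smooth_at_vector.
- exact: proj_cone_chain chainZ.
- by move=> h; apply: non_degenerate_hull.
- by apply: (line_cone_chain (x := x) _ chainY) => l [].
- by move=> v [l /YL Ll vl]; apply: (line_hull l).
(* The rows of [A] are gradients at x. The vectors x + t v stay on a line contained in X, so [v] is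
   tangent to X at x. *)
move=> v [l /YL Ll vl]; apply/rowP => k; rewrite !mxE.
have [f If e] := GA k.
have fv : \sum_i f^`M(i).@[homcoord x 0] * v 0 i = 0.
  apply: derivative_along_line => t; apply: (homogeneous_ideal_hull If).
  apply: (line_hull l) => //; apply: memvD; last exact: memvZ.
  by apply: (subvP Ll.2); apply/mem_proj; exists 1; rewrite scale1r.
rewrite -[RHS]fv; apply: eq_bigr => j _.
by have /rowP/(_ j) := e; rewrite !mxE => ->; rewrite mulrC.
Qed.

Theorem proposition3p1 (R : realType) (N n c a : nat)
    (X : set (proj R[i] N)) (L : set (line R[i] N))
    (X_variety : projective_variety X)
    (X_dim : has_dim X n)
    (X_smooth : smooth X n)
    (X_nondegenerate : non_degenerate X)
    (n_ge1 : (1 <= n)%N)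
    (c_codim : c%:Z = N%:Z - n%:Z)
    (L_component : irreducible_component (lines_in X) L)
    (X_covered : covered_by X L)
    (a_dim : general_point X (fun x => has_dim (lines_through L x) a))
    (a_ge : n%:Z - c%:Z <= a%:Z) :
  a%:R <= (n%:R + c%:R - 3) / 2 :> rat.
Proof.
(* The open set of general points meets X, and one point of it suffices. *)
have [U [_ [x [Xx Ux]] aU]] := a_dim; have [LX _ _] := L_component.
have char0 k : k.+1%:R != 0 :> R[i] by rewrite Num.Theory.pnatr_eq0.
have bound : (2 * a + 3 <= n + c)%N.
  apply: (lines_through_point_bound char0 X_variety X_dim X_smooth X_nondegenerate
    _ LX Xx (aU x Xx Ux)); [by move: c_codim; lia|by move: a_ge; lia].
rewrite Num.Theory.ler_pdivlMr // Num.Theory.lerBrDr -!natrD -natrM.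
by rewrite -natrD Num.Theory.ler_nat mulnC.
Qed.
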